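(* Let $n=2p+1$ with $p\ge 0$ an integer, let $R>0$, let $\vec s\in\mathbb{R}^n$ with $s=|\vec s|<R$. Then \[\frac{1}{n!\,\omega_n}\int_{\vec x\in S^{n-1}_R}e^{-|\vec x-\vec s|}\,\mathrm{d}\vec x=\frac{(-1)^pe^{-R}}{2^pp!}\sum_{i=0}^p\binom{p}{i}\chi_{p+i}(R)\tau_i(s).\]
   Context: $S^{n-1}_R$ is the sphere of radius $R$ centred at the origin with its surface measure, and $\omega_n$ is the volume of the unit $n$-ball. The reverse Bessel polynomials are defined by $\chi_0(R)=1$, $\chi_1(R)=R$, $\chi_{i+2}(R)=R^2\chi_i(R)+(2i+1)\chi_{i+1}(R)$. The functions $\tau_i$ are defined by $\tau_0=\cosh$ and $\tau_{i+1}(s)=-\frac1s\tau_i'(s)$ for $s\ne0$; each $\tau_i$ extends to an even real-analytic function on $\mathbb{R}$, and $\tau_i(0)$ denotes the value of this extension. *)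

(* Defs.v *)
From HB Require Import structures.
From mathcomp Require Import all_boot all_order all_algebra.
From mathcomp Require Import all_classical all_reals all_analysis.
Set Implicit Arguments. Unset Strict Implicit. Unset Printing Implicit Defensive.
Import Order.TTheory GRing.Theory Num.Theory.
Import numFieldNormedType.Exports.
Local Open Scope ring_scope.

Section Defs.
Variable R : realType.

Definition eucl_norm (n : nat) (x : n.-tuple R) : R :=
  Num.sqrt (\sum_(i < n) tnth x i ^+ 2).

Definition eucl_dist (n : nat) (x y : n.-tuple R) : R :=
  Num.sqrt (\sum_(i < n) (tnth x i - tnth y i) ^+ 2).

Definition tscale (n : nat) (c : R) (x : n.-tuple R) : n.-tuple R :=
  map_tuple (fun a => c * a) x.

(** Lebesgue integral over R^n of a nonnegative (extended-real valued)
    function, as the iterated integral over the coordinates w.r.t. the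
    one-dimensional Lebesgue measure (= the n-dimensional Lebesgue integral
    for nonnegative measurable functions, by Tonelli). *)
Fixpoint lebint (n : nat) : (n.-tuple R -> \bar R) -> \bar R :=
  match n return (n.-tuple R -> \bar R) -> \bar R with
  | 0 => fun f => f [tuple]
  | k.+1 => fun f =>
      (\int[@lebesgue_measure R]_x lebint (fun t : k.-tuple R => f [tuple of x :: t]))%E
  end.

Definition omega (n : nat) : R :=
  fine (lebint (fun x : n.-tuple R => (if eucl_norm x < 1 then 1 else 0)%:E)).

(** Integral over the unit sphere S^{n-1} w.r.t. its surface measure, defined
    by polar coordinates (Folland, Real Analysis, Thm 2.49):
    sigma(A) = n * lambda_n { r u : 0 < r <= 1, u in A }, i.e.
    int_{S^{n-1}} g dsigma = n * int_{B_1} g (x/|x|) dx. *)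
Definition unit_sphere_int (n : nat) (g : n.-tuple R -> \bar R) : \bar R :=
  (n%:R%:E * lebint (fun x : n.-tuple R =>
      if (eucl_norm x < 1)%R then g (tscale (eucl_norm x)^-1 x) else 0))%E.

Definition sphere_int (n : nat) (Rad : R) (f : n.-tuple R -> \bar R) : \bar R :=
  ((Rad ^+ n.-1)%:E * unit_sphere_int (fun u => f (tscale Rad u)))%E.

(** Reverse Bessel polynomials chi_i(Rad): chi_pair k = (chi_k, chi_(k+1)). *)
Fixpoint chi_pair (Rad : R) (k : nat) : R * R :=
  match k with
  | 0 => (1, Rad)
  | j.+1 => let: (a, b) := chi_pair Rad j in (b, Rad ^+ 2 * a + (j.*2.+1)%:R * b)
  end.
Definition chi (i : nat) (Rad : R) : R := (chi_pair Rad i).1.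

Definition cosh (s : R) : R := (expR s + expR (- s)) / 2.

(** tau_0 = cosh, tau_(i+1)(s) = -(1/s) tau_i'(s) for s <> 0, and at s = 0
    the value of the (continuous) extension, i.e. the limit at 0. *)
Fixpoint tau (i : nat) : R -> R :=
  match i with
  | 0 => cosh
  | j.+1 => fun s =>
      if s != 0 then - (derive1 (tau j) s) / s
      else lim ((fun t => - (derive1 (tau j) t) / t) @ 0^')%classic
  end.

End Defs.

(* Main.v *)
Require Import Defs.
From HB Require Import structures.
From mathcomp Require Import all_boot all_order all_algebra.
From mathcomp Require Import all_classical all_reals all_analysis.
From mathcomp Require Import measurable_realfun ring lra.
Set Implicit Arguments. Unset Strict Implicit. Unset Printing Implicit Defensive.
Import Order.TTheory GRing.Theory Num.Theory.
Import numFieldNormedType.Exports.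
Local Open Scope ring_scope.
Local Open Scope classical_set_scope.

(** Proof idea. A rotation in two coordinates is a composition of affine
    substitutions in one variable, so Tonelli alone reduces the integral over
    the ball to [c \int psi (|s| t / q) q^-n dt], with [q = sqrt (1 + t^2)] the
    polar coordinate of the slope [t], [psi y = exp (- sqrt (R^2 + s^2 - 2 R y))],
    and the same constant [c] for [psi = 1], i.e. for [omega n].  With
    [y = 2 R s t / q] and [m = R^2 + s^2] fixed, integrating by parts [p - 1]
    times turns this into the iterated primitive [V_p (2 R s)], where
    [V_1' = exp (- sqrt (m + y)) + exp (- sqrt (m - y))] and
    [V_(j+1)' = 2 y V_j].  Writing [y = 2 r s] with [r^2 + s^2 = m], these
    primitives are [V_p = (-2)^p y^(2p-1) T_p (r, s)] with
    [T_p = \sum_i 'C(p, i) r^(2i) k_(p+i)(r) tau_i(s)] and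
    [k_j = exp (- r) chi_j / r^(2j)]: both [k] and [tau] satisfy
    [f_j' = - x f_(j+1)] and [x^2 f_(j+2) = f_j + (2j+1) f_(j+1)], which gives
    [(2p-1) T_p + y T_p' = - T_(p-1)]. *)

(** * One-dimensional substitutions and Tonelli *)

Section affine.
Context {R : realType}.
Local Notation mu := (@lebesgue_measure R).
Local Open Scope ereal_scope.

(** [|a|] times the pushforward of Lebesgue measure under [a * x + b] gives every interval []c, d]]
    its length, so uniqueness identifies it with Lebesgue measure. *)
Lemma ge0_integral_affine (f : R -> \bar R) (a b : R) : a != 0%R ->
  measurable_fun [set: R] f -> (forall x, 0 <= f x) ->
  \int[mu]_x f (a * x + b)%R = (`|a|^-1)%:E * \int[mu]_x f x.
Proof.
move=> a0 mf f0.
pose phi : measurableTypeR R -> measurableTypeR R := fun x => (a * x + b)%R.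
have mphi : measurable_fun setT phi.
  by apply: measurable_funD => //; apply: measurable_funM.
pose k : {nonneg R} := NngNum (normr_ge0 a).
pose nu0 : {measure set (measurableTypeR R) -> \bar R} :=
  mscale k (pushforward mu phi).
pose nu := nu0 mphi.
have an0 : (0 < `|a|)%R by rewrite normr_gt0.
have E A : measurable A -> mu A = nu A.
  apply: lebesgue_measure_unique => X [[c d]] _ <-.
  rewrite /nu /nu0 /mscale/= /pushforward.
  rewrite lebesgue_measure_itv/= lte_fin.
  have [apos|aneg] : (0 < a)%R \/ (a < 0)%R by case: ltgtP a0; auto.
    have H : phi @^-1` `]c, d] = `]((c - b) / a)%R, ((d - b) / a)%R].
      apply/seteqP; split => x /=; rewrite !in_itv/= /phi;
        rewrite ltr_pdivrMr// ler_pdivlMr//; lra.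
    rewrite [X in _ = _ * mu X]H lebesgue_measure_itv/= lte_fin ltr_pM2r ?invr_gt0// ltrD2r.
    case: ifPn => _; last by rewrite mule0.
    by rewrite gtr0_norm// -!EFinD -EFinM; congr EFin; field.
  (* For [a < 0] the preimage is half-open on the other side, with the same length formula. *)
  have H : phi @^-1` `]c, d] = `[((d - b) / a)%R, ((c - b) / a)%R[.
    apply/seteqP; split => x /=; rewrite !in_itv/= /phi;
      rewrite ltr_ndivlMr// ler_ndivrMr//; lra.
  rewrite [X in _ = _ * mu X]H lebesgue_measure_itv/= lte_fin ltr_nM2r ?invr_lt0// ltrD2r.
  case: ifPn => _; last by rewrite mule0.
  by rewrite ltr0_norm// -!EFinD -EFinM; congr EFin; field.
have -> : \int[mu]_x f x = \int[nu]_x f x.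
  by apply: eq_measure_integral => A mA _; exact: E.
rewrite ge0_integral_mscale//= ge0_integral_pushforward//=.
by rewrite muleA -EFinM mulVf ?gt_eqF// mul1e.
Qed.

Lemma ge0_integral_scale (f : R -> \bar R) (a : R) : a != 0%R ->
  measurable_fun [set: R] f -> (forall x, 0 <= f x) ->
  \int[mu]_x f (a * x)%R = (`|a|^-1)%:E * \int[mu]_x f x.
Proof.
move=> a0 mf f0; rewrite -(@ge0_integral_affine _ _ 0)//.
by apply: eq_integral => x _; rewrite addr0.
Qed.

Lemma tonelliR (f : R * R -> \bar R) :
  measurable_fun [set: R * R] f -> (forall x, 0 <= f x) ->
  \int[mu]_x \int[mu]_y f (x, y) = \int[mu]_y \int[mu]_x f (x, y).
Proof. by move=> mf f0; exact: (@fubini_tonelli _ _ _ _ _ mu mu f). Qed.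

Lemma measurable_integral2 d (T : measurableType d) (f : T * R -> \bar R) :
  measurable_fun [set: T * R] f -> (forall x, 0 <= f x) ->
  measurable_fun [set: T] (fun t => \int[mu]_y f (t, y)).
Proof.
by move=> mf f0; exact: (@measurable_fun_fubini_tonelli_F _ _ _ _ _ mu f).
Qed.

(** The origin is a null set, so substitutions that divide by the variable may leave it out. *)
Lemma eq_integral_neq0 (f g : R -> \bar R) :
  measurable_fun [set: R] f -> measurable_fun [set: R] g ->
  (forall x, x != 0%R -> f x = g x) -> \int[mu]_x f x = \int[mu]_x g x.
Proof.
move=> mf mg fg.
have mD : measurable ([set: R] `\ 0%R) by exact: measurableD.
rewrite -(@integral_setD1 R f 0%R setT)//; last exact: measurable_funS mf.
rewrite -(@integral_setD1 R g 0%R setT)//; last exact: measurable_funS mg.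
by apply: eq_integral => x; rewrite inE/= => -[_ /eqP/fg].
Qed.

End affine.

(** * Measurability of inverses, square roots and composite integrands *)

Section measurability.
Context {R : realType}.

Lemma measurable_fun_inv d (T : measurableType d) (f : T -> R) :
  measurable_fun setT f -> measurable_fun setT (fun x => (f x)^-1).
Proof.
move=> mf.
(* Inversion jumps at 0, so it is written with a measurable power of [f x ^+ 2]; at the zeros of [f]
   both sides are 0 because [0^-1 = 0]. *)
rewrite (_ : (fun x => _) = fun x => f x * ((f x ^+ 2) `^ (-1))).
  apply: measurable_funM => //.
  apply: (measurableT_comp (measurable_powR _)).
  exact: measurable_funX.
apply/funext => x.
have [->|f0] := eqVneq (f x) 0; first by rewrite invr0 mul0r.
rewrite powR_inv1 ?sqr_ge0//; by field.
Qed.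

Lemma measurable_fun_sqrt d (T : measurableType d) (f : T -> R) :
  measurable_fun setT f -> measurable_fun setT (fun x => Num.sqrt (f x)).
Proof.
move=> mf; apply: (measurableT_comp _ mf).
by apply: continuous_measurable_fun; exact: sqrt_continuous.
Qed.

End measurability.

Ltac mfun := cbn beta; repeat match goal with
  | |- measurable_fun _ (fun x => x) => exact: measurable_id
  | |- measurable_fun _ fst => exact: measurable_fst
  | |- measurable_fun _ snd => exact: measurable_snd
  | |- measurable_fun _ (fun x => x.1) => exact: measurable_fst
  | |- measurable_fun _ (fun x => x.2) => exact: measurable_snd
  | |- measurable_fun _ (fun x => ?c) => exact: measurable_cst
  | H : measurable_fun _ ?F |- measurable_fun _ ?F => exact: H
  | |- measurable_fun _ (fun x => (_, _)) => apply: measurable_fun_pair; cbn beta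
  | |- measurable_fun _ (fun x => (_ * _)%R) => apply: measurable_funM; cbn beta
  | |- measurable_fun _ (fun x => (_ - _)%R) => apply: measurable_funB; cbn beta
  | |- measurable_fun _ (fun x => (_ + _)%R) => apply: measurable_funD; cbn beta
  | |- measurable_fun _ (fun x => (- _)%R) => apply: measurableT_comp; cbn beta
  | |- measurable_fun _ (fun x => (_ ^-1)%R) => apply: measurable_fun_inv; cbn beta
  | |- measurable_fun _ (fun x => Num.sqrt _) => apply: measurable_fun_sqrt; cbn beta
  | |- measurable_fun _ (fun x => (_ ^+ _)%R) => apply: measurable_funX; cbn beta
  | |- measurable_fun _ (fun x => `| _ |%R) => apply: (measurableT_comp (@normr_measurable _ _)); cbn beta
  | |- measurable_fun _ (fun x => (_ * _)%E) => apply: emeasurable_funM; cbn beta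
  | |- measurable_fun _ (fun x => (_)%:E) => apply/measurable_EFinP; rewrite /comp; cbn beta
  | |- measurable_fun _ (fun x => (@?f x).1) => apply: (measurableT_comp measurable_fst (g := f)); cbn beta
  | |- measurable_fun _ (fun x => (@?f x).2) => apply: (measurableT_comp measurable_snd (g := f)); cbn beta
  | H : measurable_fun _ ?F |- measurable_fun _ (fun x => ?F (@?g x)) => apply: (measurableT_comp H (g := g)); cbn beta
  end.

(** * Polar coordinates and rotations in the plane *)

Section polar.
Context {R : realType}.
Local Notation mu := (@lebesgue_measure R).
Local Open Scope ereal_scope.

Definition hyp (t : R) : R := Num.sqrt (1 + t ^+ 2)%R.

Lemma hyp_sqr t : (hyp t ^+ 2 = 1 + t ^+ 2)%R.
Proof. by rewrite sqr_sqrtr// addr_ge0// sqr_ge0. Qed.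

Lemma hyp_gt0 t : (0 < hyp t)%R.
Proof. by rewrite sqrtr_gt0 ltr_pwDl// sqr_ge0. Qed.

Lemma measurable_hyp : measurable_fun [set: R] hyp.
Proof. rewrite /hyp; mfun. Qed.

(** Substitute [x = |z| t] for fixed [z], then [z = w / hyp t] for fixed [t], with Tonelli in
    between: [t] is a slope and [|w|] the distance to the origin. *)
Lemma integral_polar (F : R * R -> \bar R) :
  measurable_fun [set: R * R] F -> (forall x, 0 <= F x) ->
  \int[mu]_x \int[mu]_z F (x, z) =
  \int[mu]_t \int[mu]_w
    ((`|w| / hyp t ^+ 2)%:E * F (`|w| * t / hyp t, w / hyp t)%R).
Proof.
move=> mF F0; have mh := measurable_hyp.
rewrite (tonelliR mF F0).
pose K (p : R * R) := `|p.2|%:E * F (`|p.2| * p.1, p.2)%R.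
have mK : measurable_fun setT K by rewrite /K; mfun.
have K0 p : 0 <= K p by rewrite mule_ge0// lee_fin.
transitivity (\int[mu]_z \int[mu]_t K (t, z)).
  apply: eq_integral_neq0.
  - by apply: (@measurable_integral2 R _ R (fun p => F (p.2, p.1))) => //; mfun.
  - by apply: (@measurable_integral2 R _ R (fun p => K (p.2, p.1))) => //; mfun.
  move=> z z0.
  rewrite /K/= ge0_integralZl//=; last by mfun.
  rewrite (@ge0_integral_scale R (fun x => F (x, z)))//; last by mfun.
    by rewrite muleA -EFinM normr_id mulfV ?normr_eq0// mul1e.
  by rewrite normr_eq0.
transitivity (\int[mu]_t \int[mu]_z K (t, z)); first exact/esym/tonelliR.
apply: eq_integral => t _.
have q0 := hyp_gt0 t.
have qV0 : ((hyp t)^-1 != 0)%R by rewrite invr_neq0 ?gt_eqF.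
have mKt : measurable_fun setT (fun z : R => K (t, z)) by mfun.
have Kt0 z : 0 <= K (t, z) by [].
have := ge0_integral_scale qV0 mKt Kt0.
rewrite normfV (gtr0_norm q0) invrK => H.
have -> : \int[mu]_z K (t, z) =
    ((hyp t)^-1)%:E * \int[mu]_w K (t, (hyp t)^-1 * w)%R.
  by rewrite H muleA -EFinM mulVf ?gt_eqF// mul1e.
rewrite -ge0_integralZl//=; last 2 first.
- by mfun.
- by rewrite lee_fin invr_ge0 ltW.
apply: eq_integral => w _; rewrite /K/= muleA -EFinM.
rewrite normrM normfV (gtr0_norm q0).
have qn0 : hyp t != 0%R by rewrite gt_eqF.
congr (_%:E * F _); first by field.
by congr (_, _); field.
Qed.

(* Rotation by an angle with sine [b <> 0] factors through two affine
   substitutions in one variable each, so that Tonelli suffices. *)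
Lemma integral_rot (H : R * R -> \bar R) (a b : R) :
  measurable_fun [set: R * R] H -> (forall x, 0 <= H x) ->
  \int[mu]_x \int[mu]_y H (x ^+ 2 + y ^+ 2, a * x + b * y)%R =
  \int[mu]_x \int[mu]_y H (x ^+ 2 + y ^+ 2, Num.sqrt (a ^+ 2 + b ^+ 2) * x)%R.
Proof.
move=> mH H0; set r := Num.sqrt _.
(* For [b = 0] a reflection of [x] at most is required, to turn [a] into [|a|]. *)
have [b0|b0] := eqVneq b 0%R.
  have rE : r = `|a|%R by rewrite /r b0 expr0n/= addr0 sqrtr_sqr.
  rewrite rE b0.
  under eq_integral do under eq_integral do rewrite mul0r addr0.
  have [a0|a0] := leP 0%R a; first by rewrite ger0_norm.
  rewrite (ltr0_norm a0).
  pose f x := \int[mu]_y H (x ^+ 2 + y ^+ 2, a * x)%R.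
  have mf : measurable_fun [set: R] f.
    by apply: (@measurable_integral2 R _ R
      (fun p => H (p.1 ^+ 2 + p.2 ^+ 2, a * p.1)%R)) => //; mfun.
  have f0 x : 0 <= f x by exact: integral_ge0.
  have N10 : (- 1 : R)%R != 0%R by rewrite oppr_eq0 oner_eq0.
  have := ge0_integral_scale N10 mf f0.
  rewrite normrN1 invr1 mul1e -/(f _) => <-.
  apply: eq_integral => x _; apply: eq_integral => y _.
  by congr (H (_, _)); rewrite !mulN1r ?sqrrN// mulNr mulrN.
have r0 : (0 < r)%R.
  by rewrite sqrtr_gt0 ltr_wpDl ?sqr_ge0// lt_neqAle sqr_ge0 eq_sym sqrf_eq0 b0.
have r2 : (r ^+ 2 = a ^+ 2 + b ^+ 2)%R by rewrite sqr_sqrtr// addr_ge0// sqr_ge0.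
(* For fixed [x], [u = (a x + b y) / r] replaces [y]; [K] is the integrand in [(x, u)]. *)
pose K (p : R * R) := H (p.1 ^+ 2 + ((r * p.2 - a * p.1) / b) ^+ 2, r * p.2)%R.
have mK : measurable_fun setT K by rewrite /K; mfun.
have rn0 : r != 0%R by rewrite gt_eqF.
have rb0 : (r / b)%R != 0%R by rewrite mulf_neq0// invr_neq0.
transitivity (\int[mu]_x ((`|r / b|)%:E * \int[mu]_u K (x, u))).
  apply: eq_integral => x _.
  have mf : measurable_fun setT (fun y : R => H (x ^+ 2 + y ^+ 2, a * x + b * y)%R).
    by mfun.
  have /= := ge0_integral_affine (- (a * x / b)) rb0 mf (fun _ => H0 _).
  move=> E; transitivity (`|r / b|%:E * (`|r / b|^-1%:E *
      \int[mu]_y H (x ^+ 2 + y ^+ 2, a * x + b * y)%R)).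
    by rewrite muleA -EFinM mulfV ?normr_eq0// mul1e.
  rewrite -E; congr (_ * _); apply: eq_integral => u _; rewrite /K/=.
  by congr (H (_ + _ ^+ 2, _)%R); field.
rewrite ge0_integralZl//; last 2 first.
- by apply: (@measurable_integral2 R _ R K) => //; move=> p; exact: H0.
- by move=> x _; apply: integral_ge0 => u _; exact: H0.
rewrite (tonelliR mK (fun _ => H0 _)) -ge0_integralZl//; last 2 first.
- by apply: (@measurable_integral2 R _ R (fun p => K (p.2, p.1))) => //; [mfun|move=> p; exact: H0].
- by move=> x _; apply: integral_ge0 => u _; exact: H0.
apply: eq_integral => u _.
(* For fixed [u], substituting [x = - (b / r) y + a u / r] turns the sum of squares into
   [u ^+ 2 + y ^+ 2]. *)
have br0 : (- (b / r))%R != 0%R by rewrite oppr_eq0 mulf_neq0// invr_neq0.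
have mf : measurable_fun setT (fun x : R => K (x, u)) by mfun.
have /= := ge0_integral_affine (a * u / r) br0 mf (fun _ => H0 _).
rewrite normrN !normf_div invf_div => <-.
apply: eq_integral => y _; rewrite /K/=; congr (H (_, _)).
rewrite (_ : (r * u - a * (- (b / r) * y + a * u / r)) / b =
    (b * u + a * y) / r)%R.
  have -> : ((- (b / r) * y + a * u / r) ^+ 2 + ((b * u + a * y) / r) ^+ 2 =
     (a ^+ 2 + b ^+ 2) * (u ^+ 2 + y ^+ 2) / r ^+ 2)%R by field.
  by rewrite -r2; field.
have -> : (r * u - a * (- (b / r) * y + a * u / r) =
   ((r ^+ 2 - a ^+ 2) * u + a * b * y) / r)%R by field.
by rewrite r2; field; rewrite b0 rn0.
Qed.

End polar.

(** * Slicing the iterated integral *)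

Section slice.
Context {R : realType}.
Local Notation mu := (@lebesgue_measure R).
Local Open Scope ereal_scope.

(** Moves slope integrals to the half-line, where the fundamental theorem of calculus is applied and
    the values at [t] and [- t] combine. *)
Lemma ge0_integral_fold (f : R -> \bar R) :
  measurable_fun [set: R] f -> (forall x, 0 <= f x) ->
  \int[mu]_x f x = \int[mu]_(x in `[0%R, +oo[) (f x + f (- x)%R).
Proof.
move=> mf f0.
have mfN : measurable_fun [set: R] (fun x => f (- x)%R).
  exact: (measurableT_comp mf).
have f0N x : 0 <= f (- x)%R by [].
rewrite ge0_integralD//=; last 2 first.
- exact: measurable_funS mf.
- exact: measurable_funS mfN.
rewrite (ge0_integration_by_substitution0 mfN f0N).
under [X in _ = _ + X]eq_integral do rewrite opprK.
rewrite -(@integral_setD1 R f 0%R `]-oo, 0%R]); last 2 first.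
- exact: measurableD.
- exact: measurable_funS mf.
rewrite -ge0_integral_setU//=; last 3 first.
- exact: measurableD.
- exact: measurable_funS mf.
- apply/disj_setPS => x [/=]; rewrite !in_itv/= andbT => x0 [x1 /eqP].
  by rewrite eq_le x0 x1.
congr (integral _ _ _); apply/seteqP; split => // x _ /=.
rewrite !in_itv/= andbT; have [x0|x0] := leP 0%R x; first by left.
by right; split; [exact: ltW|apply/eqP; rewrite lt_eqF].
Qed.

(** Since [hyp t >= 1], the integrand is at most [1 / (1 + t ^+ 2)], which is integrable. *)
Lemma integral_hyp_fin k :
  exists2 c : R, (0 <= c)%R & \int[mu]_t (hyp t ^- k.+2)%:E = c%:E.
Proof.
have h0 t : (0 <= hyp t ^- k.+2)%R by rewrite invr_ge0 exprn_ge0// ltW// hyp_gt0.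
have mh : measurable_fun setT (fun t : R => hyp t ^- k.+2)%R.
  by have mh0 := @measurable_hyp R; mfun.
have mo : measurable_fun [set: R] (fun t : R => (oneDsqr t)^-1%:E).
  apply/measurable_EFinP/measurable_fun_inv.
  by apply: continuous_measurable_fun; exact: continuous_oneDsqr.
suff : \int[mu]_t (hyp t ^- k.+2)%:E < +oo.
  move=> fin; exists (fine (\int[mu]_t (hyp t ^- k.+2)%:E)).
    by apply: fine_ge0; apply: integral_ge0 => t _; rewrite lee_fin; exact: h0.
  by rewrite fineK ?ge0_fin_numE ?integral_ge0 //= => t _; rewrite lee_fin; exact: h0.
apply: (@le_lt_trans _ _ (\int[mu]_t ((oneDsqr t)^-1)%:E)).
  apply: ge0_le_integral => //.
  - by move=> t _; rewrite lee_fin h0.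
  - exact/measurable_EFinP.
  move=> t _; rewrite lee_fin lef_pV2 ?posrE ?exprn_gt0 ?hyp_gt0//.
  rewrite -addn2 exprD -[X in (_ <= _ * X)%R]/(hyp t ^+ 2)%R hyp_sqr /oneDsqr.
  rewrite ler_peMl ?addr_ge0 ?sqr_ge0// exprn_ege1//.
  by rewrite -[leLHS]sqrtr1 ler_wsqrtr// lerDl sqr_ge0.
rewrite ge0_integral_fold; last 2 first.
- exact: mo.
- by move=> t; rewrite lee_fin invr_ge0 addr_ge0// sqr_ge0.
under eq_integral do rewrite /oneDsqr sqrrN -/(oneDsqr _).
rewrite ge0_integralD//= ?integral0y_oneDsqr ?ltry//.
all: exact: measurable_funS mo.
Qed.

(** In the coordinates of [integral_polar] slope and radius separate; [c] is the slope integral of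
    [hyp t ^- k.+2], the same for all [h]. *)
Lemma integral_radial k : exists2 c : R, (0 <= c)%R &
  forall h : R -> \bar R, measurable_fun [set: R] h -> (forall x, 0 <= h x) ->
  \int[mu]_x \int[mu]_z ((`|z| ^+ k)%:E * h (x ^+ 2 + z ^+ 2)%R) =
  c%:E * \int[mu]_w ((`|w| ^+ k.+1)%:E * h (w ^+ 2)%R).
Proof.
have [c c0 cE] := integral_hyp_fin k.
exists c; first exact: c0.
move=> h mh h0.
have mhyp := @measurable_hyp R.
have h0' t : (0 <= hyp t ^- k.+2)%R by rewrite invr_ge0 exprn_ge0// ltW// hyp_gt0.
rewrite (@integral_polar R (fun p => (`|p.2| ^+ k)%:E * h (p.1 ^+ 2 + p.2 ^+ 2)%R));
  last 2 first.
- by mfun.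
- by move=> p; rewrite mule_ge0// lee_fin exprn_ge0.
rewrite -cE -ge0_integralZr//=; last 3 first.
- by mfun.
- by move=> t _; rewrite lee_fin; exact: h0'.
- by apply: integral_ge0 => t _; rewrite mule_ge0// lee_fin exprn_ge0.
apply: eq_integral => t _; rewrite -ge0_integralZl//=; last 3 first.
- by mfun.
- by move=> w _; rewrite mule_ge0// lee_fin exprn_ge0.
- by rewrite lee_fin; exact: h0'.
have q0 := hyp_gt0 t.
have qn0 : hyp t != 0%R by rewrite gt_eqF.
apply: eq_integral => w _.
rewrite !muleA -!EFinM; congr (_%:E * h _).
  by rewrite normrM normfV (gtr0_norm q0) !exprS exprMn exprVn; field; rewrite ?expf_neq0 ?qn0.
have -> : ((`|w| * t / hyp t) ^+ 2 + (w / hyp t) ^+ 2 =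
   w ^+ 2 * (1 + t ^+ 2) / hyp t ^+ 2)%R.
  by rewrite !exprMn (_ : `|w| ^+ 2 = w ^+ 2)%R ?real_normK ?num_real//; field.
by rewrite -hyp_sqr; field.
Qed.

Definition sqn n (x : n.-tuple R) : R := (\sum_(i < n) tnth x i ^+ 2)%R.
Definition dotp n (x s : n.-tuple R) : R := (\sum_(i < n) tnth x i * tnth s i)%R.

Lemma sqn_cons n a (t : n.-tuple R) : sqn [tuple of a :: t] = (a ^+ 2 + sqn t)%R.
Proof.
rewrite /sqn big_ord_recl tnth0; congr (_ + _)%R.
by apply: eq_bigr => i _; rewrite tnthS.
Qed.

Lemma dotp_cons n a b (t s : n.-tuple R) :
  dotp [tuple of a :: t] [tuple of b :: s] = (a * b + dotp t s)%R.
Proof.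
rewrite /dotp big_ord_recl !tnth0; congr (_ + _)%R.
by apply: eq_bigr => i _; rewrite !tnthS.
Qed.

Lemma sqn_ge0 n (t : n.-tuple R) : (0 <= sqn t)%R.
Proof. by apply: sumr_ge0 => i _; exact: sqr_ge0. Qed.

Lemma eucl_norm_cons n a (t : n.-tuple R) :
  eucl_norm [tuple of a :: t] = Num.sqrt (a ^+ 2 + eucl_norm t ^+ 2).
Proof. by rewrite /eucl_norm -/(sqn _) sqn_cons sqr_sqrtr// sqn_ge0. Qed.

Lemma lebint1 (s : 1.-tuple R) (G : R * R -> \bar R) :
  measurable_fun [set: R * R] G -> (forall p, 0 <= G p) ->
  lebint (fun x => G (sqn x, dotp x s)) =
  \int[mu]_x G (x ^+ 2, eucl_norm s * x)%R.
Proof.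
move=> mG G0; case/tupleP: s => a s; rewrite eucl_norm_cons /=.
rewrite (tuple0 s) {1}/eucl_norm big_ord0 sqrtr0 expr0n/= addr0 sqrtr_sqr.
under eq_integral do
  rewrite sqn_cons dotp_cons /sqn /dotp !big_ord0 !addr0 mulrC.
have [a0|a0] := leP 0%R a; first by rewrite ger0_norm.
rewrite ltr0_norm//.
have N10 : (- 1 : R)%R != 0%R by rewrite oppr_eq0 oner_eq0.
have mf : measurable_fun setT (fun x : R => G (x ^+ 2, a * x)%R) by mfun.
have := ge0_integral_scale N10 mf (fun _ => G0 _).
rewrite normrN1 invr1 mul1e => <-; apply: eq_integral => x _.
by congr (G (_, _)); rewrite ?mulN1r ?sqrrN// mulNr mulrN.
Qed.

Lemma lebintS k (f : k.+1.-tuple R -> \bar R) :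
  lebint f = \int[mu]_x lebint (fun t : k.-tuple R => f [tuple of x :: t]).
Proof. by []. Qed.

(** Induction on the dimension. The hypothesis treats the tail of [s], a rotation aligns [x] with
    the whole of [s], and [integral_radial] merges the variable orthogonal to [s] with the radius
    [z], raising the weight by one. The constant depends on [k] alone, so it is common to all
    integrands. *)
Lemma lebint_slice k : exists2 c : R, (0 <= c)%R &
  forall (s : k.+2.-tuple R) (G : R * R -> \bar R),
  measurable_fun [set: R * R] G -> (forall p, 0 <= G p) ->
  lebint (fun x => G (sqn x, dotp x s)) =
  c%:E * \int[mu]_x \int[mu]_z
    ((`|z| ^+ k)%:E * G (x ^+ 2 + z ^+ 2, eucl_norm s * x)%R).
Proof.
elim: k => [|k [c c0 IH]].
  exists 1%R; first exact: ler01.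
  move=> s G mG G0; rewrite mul1e.
  case/tupleP: s => a s; rewrite eucl_norm_cons.
  under [RHS]eq_integral do under eq_integral do rewrite expr0 mul1e.
  rewrite -(integral_rot _ _ mG G0).
  transitivity (\int[mu]_x lebint (fun t : 1.-tuple R =>
      G (x ^+ 2 + sqn t, a * x + dotp t s)%R)).
    rewrite lebintS; apply: eq_integral => x _; apply: (congr1 (@lebint R 1)); apply/funext => t.
    by rewrite sqn_cons dotp_cons [(a * x)%R]mulrC.
  apply: eq_integral => x _.
  rewrite (@lebint1 s (fun p => G (x ^+ 2 + p.1, a * x + p.2)%R))//.
  by mfun.
have [g g0 gE] := integral_radial k.
exists (c * g)%R; first exact: mulr_ge0.
move=> s G mG G0; case/tupleP: s => a s; rewrite eucl_norm_cons.
set S := eucl_norm s; set r := Num.sqrt _.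
transitivity (\int[mu]_x lebint (fun t : k.+2.-tuple R =>
      G (x ^+ 2 + sqn t, a * x + dotp t s)%R)).
  rewrite lebintS; apply: eq_integral => x _; apply: (congr1 (@lebint R k.+2)); apply/funext => t.
  by rewrite sqn_cons dotp_cons [(a * x)%R]mulrC.
pose H (p : R * R) := \int[mu]_z ((`|z| ^+ k)%:E * G (p.1 + z ^+ 2, p.2)%R).
have mH : measurable_fun setT H.
  apply: (@measurable_integral2 R _ _
    (fun q : (R * R) * R => (`|q.2| ^+ k)%:E * G (q.1.1 + q.2 ^+ 2, q.1.2)%R)).
    by mfun.
  by move=> q; rewrite mule_ge0// lee_fin exprn_ge0.
have H0 p : 0 <= H p.
  by apply: integral_ge0 => z _; rewrite mule_ge0// lee_fin exprn_ge0.
(* [y] is the coordinate along the tail of [s], so [a * x + S * y] is the full scalar product. *)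
transitivity (\int[mu]_x (c%:E * \int[mu]_y H (x ^+ 2 + y ^+ 2, a * x + S * y)%R)).
  apply: eq_integral => x _.
  have mGx : measurable_fun setT
    (fun p : R * R => G (x ^+ 2 + p.1, a * x + p.2)%R) by mfun.
  have E := IH s _ mGx (fun _ => G0 _).
  etransitivity; first exact: E.
  apply: (congr1 (fun u => c%:E * u)).
  apply: eq_integral => y _; apply: eq_integral => z _.
  by rewrite /= addrA.
rewrite ge0_integralZl; last 4 first.
- exact: measurableT.
- apply: (@measurable_integral2 R _ _
    (fun p : R * R => H (p.1 ^+ 2 + p.2 ^+ 2, a * p.1 + S * p.2)%R)) => //.
  by mfun.
- by move=> x _; exact: integral_ge0.
- exact: c0.
rewrite (integral_rot _ _ mH H0) EFinM -muleA; congr (_ * _).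
rewrite -ge0_integralZl//; last 2 first.
- apply: (@measurable_integral2 R _ _
    (fun p : R * R => (`|p.2| ^+ k.+1)%:E * G (p.1 ^+ 2 + p.2 ^+ 2, r * p.1)%R)).
    by mfun.
  by move=> q; rewrite mule_ge0// lee_fin exprn_ge0.
- by move=> x _; apply: integral_ge0 => z _; rewrite mule_ge0// lee_fin exprn_ge0.
(* With [x] now along [s], the orthogonal variables enter [G] only through [y ^+ 2 + z ^+ 2]. *)
apply: eq_integral => x _.
have mGx : measurable_fun setT (fun u : R => G (x ^+ 2 + u, r * x)%R).
  by mfun; exact: (@measurable_funD _ _ _ _ (cst (x ^+ 2)%R) id).
have E := gE _ mGx (fun _ => G0 _).
etransitivity; last exact: E.
apply: eq_integral => y _; apply: eq_integral => z _.
by rewrite /= addrA.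
Qed.

(** Polar coordinates for the pair formed by the coordinate along [s] and the orthogonal radius:
    [|w|] is the norm of the point and [t / hyp t] the cosine of its angle with the axis of [s]. *)
Lemma lebint_polar k : exists2 c : R, (0 <= c)%R &
  forall (s : k.+2.-tuple R) (G : R * R -> \bar R),
  measurable_fun [set: R * R] G -> (forall p, 0 <= G p) ->
  lebint (fun x => G (sqn x, dotp x s)) =
  c%:E * \int[mu]_t \int[mu]_w
    ((`|w| ^+ k.+1 * hyp t ^- k.+2)%:E *
     G (w ^+ 2, eucl_norm s * (`|w| * t / hyp t))%R).
Proof.
have [c c0 cE] := lebint_slice k.
exists c; first exact: c0.
move=> s G mG G0; etransitivity; first exact: (cE s G mG G0).
apply: (congr1 (fun u => c%:E * u)).
have mF : measurable_fun setT (fun p : R * R => (`|p.2| ^+ k)%:E *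
  G (p.1 ^+ 2 + p.2 ^+ 2, eucl_norm s * p.1)%R) by mfun.
etransitivity; first apply: (integral_polar mF).
  by move=> p; rewrite mule_ge0// lee_fin exprn_ge0.
apply: eq_integral => t _; apply: eq_integral => w _.
have q0 := hyp_gt0 t.
have qn0 : hyp t != 0%R by rewrite gt_eqF.
rewrite !muleA -!EFinM; congr (_%:E * G (_, _)).
  by rewrite normrM normfV (gtr0_norm q0) !exprS exprMn exprVn; field; rewrite ?expf_neq0 ?qn0.
have -> : ((`|w| * t / hyp t) ^+ 2 + (w / hyp t) ^+ 2 =
   w ^+ 2 * (1 + t ^+ 2) / hyp t ^+ 2)%R.
  by rewrite !exprMn (_ : `|w| ^+ 2 = w ^+ 2)%R ?real_normK ?num_real//; field.
by rewrite -hyp_sqr; field.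
Qed.

End slice.

(** * Integrals over the ball of functions of the direction *)

Section ball.
Context {R : realType}.
Local Notation mu := (@lebesgue_measure R).
Local Open Scope ereal_scope.

Lemma integral_normX_ball_fin k : exists2 a : R, (0 <= a)%R &
  \int[mu]_w (if (`|w| < 1)%R then `|w| ^+ k else 0%R)%:E = a%:E.
Proof.
have f0 w : (0 <= (if `|w| < 1 then `|w| ^+ k else 0) :> R)%R.
  by case: ifP => // _; rewrite exprn_ge0.
have mf : measurable_fun setT
    (fun w : R => if (`|w| < 1)%R then (`|w| ^+ k)%R else 0%R).
  apply: measurable_fun_ifT; [|by mfun|by mfun].
  by apply: measurable_fun_ltr; mfun.
suff : \int[mu]_w (if (`|w| < 1)%R then `|w| ^+ k else 0%R)%:E < +oo.
  move=> fin; exists (fine (\int[mu]_w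
      (if (`|w| < 1)%R then `|w| ^+ k else 0%R)%:E)); last first.
    by rewrite -[LHS]fineK ?ge0_fin_numE ?integral_ge0// => t _; rewrite lee_fin; exact: f0.
  by apply: fine_ge0; apply: integral_ge0 => t _; rewrite lee_fin; exact: f0.
apply: (@le_lt_trans _ _ (\int[mu]_w (\1_(`[(-1)%R, 1%R]) w)%:E)).
  apply: ge0_le_integral => //.
  - by move=> t _; rewrite lee_fin; exact: f0.
  - exact/measurable_EFinP.
  - by apply/measurable_EFinP; exact: measurable_indic.
  - move=> w _; rewrite lee_fin indicE; case: ifP => // w1.
    rewrite mem_set ?exprn_ile1// ?ltW//=.
    by move: w1; rewrite in_itv/= ltr_norml => /andP[/ltW -> /ltW ->].
rewrite integral_indic// setIT [X in X < _](@lebesgue_measure_itv R (Interval (BLeft (-1)%R) (BRight 1%R)))/=.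
by case: ifP => _; rewrite ?ltry// -EFinD ltry.
Qed.

(** For an integrand depending on the direction only, the [w]-integral splits off as a constant. The
    same [c] serves every [psi], hence both the sphere integral and the volume of the ball. *)
Lemma lebint_ball_angular k : exists2 c : R, (0 <= c)%R &
  forall (s : k.+2.-tuple R) (psi : R -> R) (d : R),
  measurable_fun [set: R] psi -> (forall y, 0 <= psi y)%R -> (0 <= d)%R ->
  lebint (fun x => (if (eucl_norm x < 1)%R then
      if sqn x == 0%R then d else psi (dotp x s / eucl_norm x)%R
    else 0%R)%:E) =
  c%:E * \int[mu]_t (hyp t ^- k.+2 * psi (eucl_norm s * (t / hyp t)))%:E.
Proof.
have [c c0 cE] := @lebint_polar R k.
have [a a0 aE] := integral_normX_ball_fin k.+1.
exists (c * a)%R; first by rewrite mulr_ge0.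
move=> s psi d mpsi psi0 d0.
pose G (p : R * R) := (if (Num.sqrt p.1 < 1)%R then
   if p.1 == 0%R then d else psi (p.2 / Num.sqrt p.1) else 0%R)%:E.
have mG : measurable_fun setT G.
  apply/measurable_EFinP; apply: measurable_fun_ifT; last by mfun.
    by apply: measurable_fun_ltr; mfun.
  apply: measurable_fun_ifT; [|by mfun|by mfun].
  by apply: measurable_fun_eqr; mfun.
have G0 p : 0 <= G p by rewrite lee_fin; case: ifP => // _; case: ifP.
etransitivity; first exact: (cE s G mG G0).
rewrite EFinM -muleA; apply: (congr1 (fun u => c%:E * u)).
have mh := @measurable_hyp R.
have h0 t : (0 <= hyp t ^- k.+2)%R by rewrite invr_ge0 exprn_ge0// ltW// hyp_gt0.
rewrite -ge0_integralZl//=; last 2 first.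
- by mfun.
- by move=> t _; rewrite lee_fin mulr_ge0 ?h0 ?psi0.
apply: eq_integral => t _.
rewrite muleC -aE -ge0_integralZl//=; last 3 first.
- apply/measurable_EFinP; apply: measurable_fun_ifT; [|by mfun|by mfun].
  by apply: measurable_fun_ltr; mfun.
- by move=> w _; rewrite lee_fin; case: ifP => // _; rewrite exprn_ge0.
- by rewrite lee_fin mulr_ge0 ?h0 ?psi0.
apply: eq_integral => w _; rewrite /G/= -!EFinM; congr EFin.
rewrite sqrtr_sqr sqrf_eq0.
case: ifPn => w1; last by rewrite !mulr0.
(* At the origin, where the integrand takes the separate value [d], the weight [|w| ^+ k.+1]
   vanishes. *)
have [->|w0] := eqVneq w 0%R; first by rewrite normr0 exprS !mul0r mulr0.
have qn0 : hyp t != 0%R by rewrite gt_eqF ?hyp_gt0.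
have wn0 : (`|w| != 0)%R by rewrite normr_eq0.
have -> : (eucl_norm s * (`|w| * t / hyp t) / `|w| = eucl_norm s * (t / hyp t))%R.
  by field; rewrite qn0 wn0.
by rewrite [RHS]mulrC [RHS]mulrA.
Qed.

End ball.

(** * Primitives of the angular integrand *)

Section derivation_rules.
Context {R : realType}.
Implicit Types f g : R -> R.

Lemma is_deriv1D f g x df dg : is_derive x (1 : R) f df -> is_derive x (1 : R) g dg ->
  is_derive x (1 : R) (fun y => f y + g y) (df + dg).
Proof. exact: is_deriveD. Qed.

Lemma is_deriv1N f x df : is_derive x (1 : R) f df ->
  is_derive x (1 : R) (fun y => - f y) (- df).
Proof. exact: is_deriveN. Qed.

Lemma is_deriv1M f g x df dg : is_derive x (1 : R) f df -> is_derive x (1 : R) g dg ->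
  is_derive x (1 : R) (fun y => f y * g y) (df * g x + f x * dg).
Proof.
move=> hf hg; apply: (is_derive_eq (is_deriveM hf hg)).
by rewrite /GRing.scale/= addrC [g x * _]mulrC.
Qed.

Lemma is_deriv1X f n x df : is_derive x (1 : R) f df ->
  is_derive x (1 : R) (fun y => f y ^+ n) (n%:R * f x ^+ n.-1 * df).
Proof.
move=> hf.
rewrite (_ : (fun y => f y ^+ n) = f ^+ n); last by apply/funext => y; rewrite exprfctE.
apply: (is_derive_eq (is_deriveX n hf)).
by rewrite /GRing.scale/= mulr_natl.
Qed.

Lemma is_deriv1V f x df : f x != 0 -> is_derive x (1 : R) f df ->
  is_derive x (1 : R) (fun y => (f y)^-1) (- df / f x ^+ 2).
Proof.
move=> f0 hf; apply: (is_derive_eq (is_deriveV f0 hf)).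
by rewrite /GRing.scale/= mulNr mulNr mulrC.
Qed.

Lemma is_deriv1_comp f g x a b :
  is_derive (g x) (1 : R) f a -> is_derive x (1 : R) g b ->
  is_derive x (1 : R) (fun y => f (g y)) (a * b).
Proof. exact: is_derive1_comp. Qed.

Lemma is_deriv1_cst (c x : R) : is_derive x (1 : R) (fun=> c) 0.
Proof. exact: is_derive_cst. Qed.

Lemma is_deriv1_id (x : R) : is_derive x (1 : R) (fun y => y) 1.
Proof. exact: is_derive_id. Qed.

Lemma is_deriv1_sqrt f x df : 0 < f x -> is_derive x (1 : R) f df ->
  is_derive x (1 : R) (fun y => Num.sqrt (f y)) (df / (2 * Num.sqrt (f x))).
Proof.
move=> f0 hf; apply: (is_derive_eq (is_derive1_comp (is_derive1_sqrt f0) hf)).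
by rewrite mulrC.
Qed.

Lemma is_deriv1_continuous f x df : is_derive x (1 : R) f df -> {for x, continuous f}.
Proof.
by move=> hf; apply: differentiable_continuous; apply/derivable1_diffP/ex_derive.
Qed.

End derivation_rules.

(** * Repeated integration by parts in the slope integral *)

Section angular.
Context {R : realType}.
Local Notation mu := (@lebesgue_measure R).
Implicit Types V : nat -> R -> R.

(** The sum over [i <= q] of [V i y * (Y ^+ 2 - y ^+ 2) ^+ (q - i) / (q - i)!]: the outcome of [q]
    integrations by parts. *)
Fixpoint iter_parts (q : nat) V (Y y : R) : R :=
  match q with
  | 0 => V 0%N y
  | j.+1 => V 0%N y * ((Y ^+ 2 - y ^+ 2) ^+ j.+1 / (j.+1)`!%:R) +
            iter_parts j (fun i => V i.+1) Y y
  end.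

(** The sum telescopes: differentiating the power in the term of [V i] lowers it by one with factor
    [- 2 y], which cancels against the derivative [2 * y * V i y] of the next primitive. *)
Lemma is_derive_iter_parts q V Y y dV :
  is_derive y (1 : R) (V 0%N) dV ->
  (forall j, is_derive y (1 : R) (V j.+1) (2 * y * V j y)) ->
  is_derive y (1 : R) (iter_parts q V Y) (dV * ((Y ^+ 2 - y ^+ 2) ^+ q / q`!%:R)).
Proof.
elim: q V dV => [|q IH] V dV hV0 hV /=.
  by apply: (is_derive_eq hV0); rewrite expr0 fact0 divr1 mulr1.
have hW := IH (fun i => V i.+1) _ (hV 0%N) (fun j => hV j.+1).
have hd : is_derive y (1 : R)
    (fun z => (Y ^+ 2 - z ^+ 2) ^+ q.+1 / (q.+1)`!%:R)
    (- (2 * y) * ((Y ^+ 2 - y ^+ 2) ^+ q / q`!%:R)).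
  have hs := is_deriv1X q.+1 (is_deriv1D (is_deriv1_cst (Y ^+ 2) y)
    (is_deriv1N (is_deriv1X 2 (is_deriv1_id y)))).
  apply: (is_derive_eq (is_deriv1M hs (is_deriv1_cst _ y))).
  rewrite /= factS natrM expr1.
  have : (q.+1)%:R != 0 :> R by rewrite pnatr_eq0.
  have : q`!%:R != 0 :> R by rewrite pnatr_eq0 -lt0n fact_gt0.
  by move=> ? ?; field; apply/andP.
apply: (is_derive_eq (is_deriv1D (is_deriv1M hV0 hd) hW)).
by rewrite mulrA; ring.
Qed.

Lemma iter_parts_diag q V Y : iter_parts q V Y Y = V q Y.
Proof.
by elim: q V => [//|q IH] V /=; rewrite subrr exprS !mul0r mulr0 add0r IH.
Qed.

Lemma iter_parts_0 q V Y : (forall j, V j 0 = 0) -> iter_parts q V Y 0 = 0.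
Proof.
by elim: q V => [|q IH] V hV /=; rewrite hV ?mul0r ?add0r ?IH.
Qed.

Lemma continuous_iter_parts q V Y y : (forall j, {for y, continuous (V j)}) ->
  {for y, continuous (iter_parts q V Y)}.
Proof.
elim: q V => [|q IH] V hV /=; first exact: hV.
apply: cvgD; last exact: (IH (fun i => V i.+1)).
apply: cvgM; first exact: hV.
apply: cvgM; last exact: cvg_cst.
suff: {for y, continuous (fun z : R => (Y ^+ 2 - z ^+ 2) ^+ q.+1)} by [].
exact: is_deriv1_continuous (is_deriv1X q.+1 (is_deriv1D (is_deriv1_cst (Y ^+ 2) y)
  (is_deriv1N (is_deriv1X 2 (is_deriv1_id y))))).
Qed.

Lemma is_derive_hyp (t : R) : is_derive t (1 : R) hyp (t / hyp t).
Proof.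
have h1 : 0 < 1 + t ^+ 2 by rewrite ltr_pwDl// sqr_ge0.
have hs := is_deriv1D (is_deriv1_cst 1 t) (is_deriv1X 2 (is_deriv1_id t)).
apply: (is_derive_eq (is_deriv1_sqrt (f := fun x => 1 + x ^+ 2) h1 hs)).
have := hyp_gt0 t; rewrite /hyp => h0; rewrite expr1; field.
by rewrite gt_eqF.
Qed.

Lemma is_derive_sine (t : R) : is_derive t (1 : R) (fun x => x / hyp x) (hyp t ^- 3).
Proof.
have qn0 : hyp t != 0 by rewrite gt_eqF ?hyp_gt0.
apply: (is_derive_eq (is_deriv1M (is_deriv1_id t) (is_deriv1V qn0 (is_derive_hyp t)))).
have h2 := hyp_sqr t.
have -> : 1 * (hyp t)^-1 + t * (- (t / hyp t) / hyp t ^+ 2) =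
  (hyp t ^+ 2 - t ^+ 2) / hyp t ^+ 3 by field.
by rewrite h2 addrK mul1r.
Qed.

Lemma sine_itv (t : R) : 0 <= t -> 0 <= t / hyp t < 1.
Proof.
move=> t0; rewrite divr_ge0 ?(ltW (hyp_gt0 t))//= ltr_pdivrMr ?hyp_gt0// mul1r.
by rewrite -(ltr_pXn2r (n := 2)) ?nnegrE ?(ltW (hyp_gt0 t))// hyp_sqr ltrDr ltr01.
Qed.

(** From [(hyp t - t) * (hyp t + t) = 1], the distance to the limit is
    [1 / (hyp t * (hyp t + t))]. *)
Lemma cvg_sine : (fun t : R => t / hyp t) @ +oo --> (1 : R).
Proof.
apply/cvgrPdist_le => e e0; near=> t.
have t0 : 0 < t by near: t; exact: nbhs_pinfty_gt.
have q0 := hyp_gt0 t.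
have /andP[s0 s1] := sine_itv (ltW t0).
rewrite ger0_norm; last by rewrite subr_ge0 ltW.
have -> : 1 - t / hyp t = (hyp t - t) / hyp t by field; rewrite gt_eqF.
rewrite ler_pdivrMr//.
have tq : t < hyp t by move: s1; rewrite ltr_pdivrMr// mul1r.
have : (hyp t - t) * (hyp t + t) = 1.
  have -> : (hyp t - t) * (hyp t + t) = hyp t ^+ 2 - t ^+ 2 by ring.
  by rewrite hyp_sqr addrK.
have t1 : 1 <= t by near: t; apply: nbhs_pinfty_ge; rewrite num_real.
have te : e^-1 <= t by near: t; apply: nbhs_pinfty_ge; rewrite num_real.
have et1 : 1 <= e * t by rewrite mulrC -ler_pdivrMr// div1r.
by nra.
Unshelve. all: by end_near. Qed.

(** The substitution [y = Y * (t / hyp t)] has [Y ^+ 2 - y ^+ 2 = (Y / hyp t) ^+ 2] and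
    [dy = Y * hyp t ^- 3 dt]. Up to constants the weight becomes [(Y ^+ 2 - y ^+ 2) ^+ q], and
    [iter_parts] is a primitive. *)
Lemma angular_integral q (m Y : R) V (H : R -> R) : 0 < Y < m ->
  (forall y, -m < y < m -> 0 <= H y) ->
  (forall y, -m < y < m -> {for y, continuous H}) ->
  (forall j y, -m < y < m -> {for y, continuous (V j)}) ->
  (forall j, V j 0 = 0) ->
  (forall y, 0 < y < m -> is_derive y (1 : R) (V 0%N) (H y)) ->
  (forall j y, 0 < y < m -> is_derive y (1 : R) (V j.+1) (2 * y * V j y)) ->
  (\int[mu]_(t in `[0%R, +oo[)
     (hyp t ^- (q.*2.+3) * H (Y * (t / hyp t)))%:E)%E =
  (q`!%:R * Y ^- (q.*2.+1) * V q Y)%:E.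
Proof.
move=> /andP[Y0 Ym] H0 cH cV V00 dV0 dV.
(* [q!] undoes the factorial in [iter_parts], and [Y ^- q.*2.+1] the powers of [Y] brought in by the
   substitution. *)
pose c : R := q`!%:R * Y ^- (q.*2.+1).
pose F t := c * iter_parts q V Y (Y * (t / hyp t)).
have Yn0 : Y != 0 by rewrite gt_eqF.
have rng t : 0 <= t -> - m < Y * (t / hyp t) < m.
  by move=> /sine_itv/andP[s0 s1]; apply/andP; split; nra.
have rng' t : 0 < t -> 0 < Y * (t / hyp t) < m.
  move=> t0; have /andP[s0 s1] := sine_itv (ltW t0).
  by rewrite mulr_gt0 ?divr_gt0 ?hyp_gt0//=; nra.
have dYs (t : R) : is_derive t (1 : R) (fun x : R => Y * (x / hyp x)) (Y * hyp t ^- 3).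
  apply: (is_derive_eq (is_deriv1M (is_deriv1_cst Y t) (is_derive_sine t))).
  by rewrite mul0r add0r.
have dF (t : R) : 0 < t -> is_derive t (1 : R) F
    (hyp t ^- (q.*2.+3) * H (Y * (t / hyp t))).
  move=> t0.
  have dW := is_derive_iter_parts q Y (dV0 _ (rng' _ t0))
    (fun j => dV j _ (rng' _ t0)).
  have dC := is_deriv1_comp (f := iter_parts q V Y)
    (g := fun x => Y * (x / hyp x)) dW (dYs t).
  apply: (is_derive_eq (is_deriv1M (is_deriv1_cst c t) dC)).
  have h2 := hyp_sqr t; have qn0 : hyp t != 0 by rewrite gt_eqF ?hyp_gt0.
  have -> : Y ^+ 2 - (Y * (t / hyp t)) ^+ 2 = (Y / hyp t) ^+ 2.
    have -> : Y ^+ 2 - (Y * (t / hyp t)) ^+ 2 =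
      Y ^+ 2 * (hyp t ^+ 2 - t ^+ 2) / hyp t ^+ 2 by field.
    by rewrite (_ : hyp t ^+ 2 - t ^+ 2 = 1) ?h2 ?addrK//; rewrite -h2; field.
  rewrite /c mul0r add0r -exprM expr_div_n mul2n.
  have fn0 : q`!%:R != 0 :> R by rewrite pnatr_eq0 -lt0n fact_gt0.
  have Yq : Y ^+ q.*2 != 0 by rewrite expf_neq0.
  have hq : hyp t ^+ q.*2 != 0 by rewrite expf_neq0.
  by rewrite !exprS; field; rewrite ?fn0 ?Yq ?hq ?Yn0 ?qn0.
have chs (t : R) : 0 <= t -> {for t, continuous
    (fun t => hyp t ^- (q.*2.+3) * H (Y * (t / hyp t)))}.
  move=> t0; apply: cvgM.
    have qn0 : hyp t ^+ (q.*2.+3) != 0 by rewrite expf_neq0 ?gt_eqF ?hyp_gt0.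
    have dh := is_deriv1V (f := fun x => hyp x ^+ (q.*2.+3)) qn0
      (is_deriv1X _ (is_derive_hyp t)).
    exact: (is_deriv1_continuous dh).
  exact: (@continuous_comp R R R (fun t => Y * (t / hyp t)) H t
    (is_deriv1_continuous (dYs t)) (cH _ (rng _ t0))).
have cF (t : R) : 0 <= t -> {for t, continuous F}.
  move=> t0.
  have cc := @continuous_comp R R R (fun t => Y * (t / hyp t)) (iter_parts q V Y) t
    (is_deriv1_continuous (dYs t))
    (@continuous_iter_parts q V Y _ (fun j => cV j _ (rng _ t0))).
  by apply: cvgM; [exact: cvg_cst|exact: cc].
rewrite (@ge0_continuous_FTC2y _ _ F _ (c * V q Y)).
- by rewrite (_ : F 0 = 0) ?sube0// /F !mul0r mulr0 iter_parts_0// mulr0.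
- by move=> t t0; rewrite mulr_ge0 ?H0 ?rng// invr_ge0 exprn_ge0// ltW// hyp_gt0.
- apply: continuous_in_subspaceT => t; rewrite inE/= in_itv/= andbT => t0.
  exact: chs.
(* At infinity [y] tends to [Y], where the primitives are continuous since [Y < m]; there only the
   last term [V q Y] of [iter_parts] is left. *)
- apply: cvgM; first exact: cvg_cst.
  rewrite -[V q Y](iter_parts_diag q V Y).
  have cW : {for Y, continuous (iter_parts q V Y)}.
    by apply: continuous_iter_parts => j; apply: cV; rewrite Ym andbT; lra.
  have cs : (fun t : R => Y * (t / hyp t)) @ +oo --> Y.
    rewrite -[X in _ --> X]mulr1.
    by apply: cvgM; [exact: cvg_cst|exact: cvg_sine].
  exact: (cvg_comp _ _ cs cW).
- by move=> t /dF dFt; exact: ex_derive.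
- by apply: cvg_at_right_filter; exact: cF.
- move=> t; rewrite in_itv/= andbT => t0.
  by have dFt := dF t t0; rewrite derive1E derive_val.
Qed.

End angular.

(** * The Bessel-type recurrences *)

Section bessel_recurrence.
Context {R : realType}.

Lemma near_neq0 (x : R) : x != 0 -> \forall y \near x, y != 0.
Proof. by move=> x0; apply: (@cvgr_neq0 _ _ _ (nbhs x) _ id x) => //; exact: cvg_id. Qed.

(** Two consecutive derivatives are carried along: near [x] the recurrence writes [f j.+2] as a
    quotient with known derivative, and the recurrence at [j.+1] brings that derivative to the
    claimed form. *)
Lemma bessel_is_derive (f : nat -> R -> R) :
  (forall x : R, x != 0 -> is_derive x (1 : R) (f 0%N) (- x * f 1%N x)) ->
  (forall x : R, x != 0 -> is_derive x (1 : R) (f 1%N) (- x * f 2 x)) ->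
  (forall j (x : R), x != 0 -> x ^+ 2 * f j.+2 x = f j x + (j.*2.+1)%:R * f j.+1 x) ->
  forall j (x : R), x != 0 -> is_derive x (1 : R) (f j) (- x * f j.+1 x).
Proof.
move=> f0 f1 frec j x x0; suff [] : is_derive x (1 : R) (f j) (- x * f j.+1 x) /\
  is_derive x (1 : R) (f j.+1) (- x * f j.+2 x) by [].
elim: j => [|j [IH0 IH1]]; first by split; [exact: f0|exact: f1].
split=> //; have x2 : x ^+ 2 != 0 by rewrite expf_neq0.
pose g y := (f j y + (j.*2.+1)%:R * f j.+1 y) / y ^+ 2.
apply: (@near_eq_is_derive _ _ _ g).
  near=> y; have y0 : y != 0 by near: y; exact: near_neq0.
  by rewrite /g -frec// mulrC mulrA mulVf ?mul1r// expf_neq0.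
have dn := is_deriv1D IH0 (is_deriv1M (is_deriv1_cst (j.*2.+1)%:R x) IH1).
have dd := is_deriv1V (f := fun y => y ^+ 2) x2 (is_deriv1X 2 (is_deriv1_id x)).
apply: (is_derive_eq (is_deriv1M dn dd)).
have e2 := frec j x x0; have e3 := frec j.+1 x x0.
have -> : f j x = x ^+ 2 * f j.+2 x - (j.*2.+1)%:R * f j.+1 x by rewrite e2 addrK.
have -> : f j.+1 x = x ^+ 2 * f j.+3 x - (j.+1.*2.+1)%:R * f j.+2 x.
  by rewrite e3 addrK.
by rewrite doubleS expr1 -addn1 -[j.*2.+3]addn3 !natrD; field.
Unshelve. all: by end_near. Qed.

Lemma near_eq_derive1 (f g : R -> R) (x df : R) : (\forall y \near x, f y = g y) ->
  is_derive x (1 : R) g df -> derive1 f x = df.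
Proof.
move=> fg dg; have gf : \forall y \near x, g y = f y.
  by apply: filterS fg => y ->.
by have dff := near_eq_is_derive gf dg; rewrite derive1E derive_val.
Qed.

(** Dividing by [x ^+ j.*2] gives [exp (- x) * chi] the same recurrence and derivation rule as
    [tau]. *)
Definition kap (j : nat) (x : R) : R := expR (- x) * chi j x / x ^+ j.*2.

Lemma chi_rec j (x : R) :
  chi j.+2 x = x ^+ 2 * chi j x + (j.*2.+1)%:R * chi j.+1 x.
Proof. by rewrite /chi /=; case: (chi_pair x j). Qed.

Lemma kap_rec j (x : R) : x != 0 ->
  x ^+ 2 * kap j.+2 x = kap j x + (j.*2.+1)%:R * kap j.+1 x.
Proof.
move=> x0; rewrite /kap chi_rec !doubleS !exprS.
have xn : x ^+ j.*2 != 0 by rewrite expf_neq0.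
by field; rewrite xn x0.
Qed.

Lemma is_derive_expRN (x : R) : is_derive x (1 : R) (fun y => expR (- y)) (- expR (- x)).
Proof.
apply: (is_derive_eq (is_deriv1_comp (is_derive_expR (- x)) (is_deriv1N (is_deriv1_id x)))).
by rewrite mulrN1.
Qed.

Lemma is_derive_kap j (x : R) : x != 0 -> is_derive x (1 : R) (kap j) (- x * kap j.+1 x).
Proof.
apply: bessel_is_derive => [{}x x0|{}x x0|]; last exact: kap_rec.
  have -> : kap 0 = fun y => expR (- y).
    by apply/funext => y; rewrite /kap /chi/= expr0 divr1 mulr1.
  apply: (is_derive_eq (is_derive_expRN x)).
  by rewrite /kap /chi/= ?doubleS ?double0; field.
apply: (@near_eq_is_derive _ _ _ (fun y => expR (- y) / y)).
  near=> y; have y0 : y != 0 by near: y; exact: near_neq0.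
  by rewrite /kap /chi/= ?doubleS ?double0; field.
apply: (is_derive_eq (is_deriv1M (is_derive_expRN x) (is_deriv1V x0 (is_deriv1_id x)))).
by rewrite /kap /chi/= !doubleS !double0; field.
Unshelve. all: by end_near. Qed.

Definition sinh (x : R) : R := (expR x - expR (- x)) / 2.

Lemma is_derive_cosh (x : R) : is_derive x (1 : R) (@cosh R) (sinh x).
Proof.
apply: (is_derive_eq (is_deriv1M (is_deriv1D (is_derive_expR x) (is_derive_expRN x))
  (is_deriv1_cst 2^-1 x))).
by rewrite /sinh mulr0 addr0.
Qed.

Lemma is_derive_sinh (x : R) : is_derive x (1 : R) sinh (cosh x).
Proof.
apply: (is_derive_eq (is_deriv1M (is_deriv1D (is_derive_expR x) (is_deriv1N (is_derive_expRN x)))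
  (is_deriv1_cst 2^-1 x))).
by rewrite /cosh mulr0 addr0 opprK.
Qed.

(** A form of [tau] without derivatives, valid off 0: the three-term recurrence started from
    [cosh x] and [- sinh x / x]. *)
Fixpoint tau_pair (x : R) (j : nat) : R * R :=
  match j with
  | 0 => (cosh x, - sinh x / x)
  | i.+1 => let: (a, b) := tau_pair x i in (b, (a + (i.*2.+1)%:R * b) / x ^+ 2)
  end.

Lemma tau_pair_rec j (x : R) : x != 0 -> x ^+ 2 * (tau_pair x j.+2).1 =
  (tau_pair x j).1 + (j.*2.+1)%:R * (tau_pair x j.+1).1.
Proof.
move=> x0 /=; case: (tau_pair x j) => a b /=.
by rewrite mulrC mulrVK// unitfE expf_neq0.
Qed.

Lemma is_derive_tau_pair j (x : R) : x != 0 ->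
  is_derive x (1 : R) (fun y => (tau_pair y j).1) (- x * (tau_pair x j.+1).1).
Proof.
apply: (@bessel_is_derive (fun j y => (tau_pair y j).1))
  => [{}x x0|{}x x0|]; last exact: tau_pair_rec.
  by apply: (is_derive_eq (is_derive_cosh x)); rewrite /=; field.
apply: (is_derive_eq (is_deriv1M (is_deriv1N (is_derive_sinh x)) (is_deriv1V x0 (is_deriv1_id x)))).
by rewrite /= double0; field.
Qed.

(** Derivation is local, so near a nonzero point the explicit formula is differentiated in place of
    [tau j]. *)
Lemma tauE j (x : R) : x != 0 -> tau j x = (tau_pair x j).1.
Proof.
elim: j x => [//|j IH] x x0.
rewrite [LHS]/= x0.
have -> : derive1 (tau j) x = - x * (tau_pair x j.+1).1.
  apply: (near_eq_derive1 _ (is_derive_tau_pair j x0)).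
  by near=> y; apply: IH; near: y; exact: near_neq0.
by field.
Unshelve. all: by end_near. Qed.

Lemma is_derive_tau j (x : R) : x != 0 ->
  is_derive x (1 : R) (tau j) (- x * tau j.+1 x).
Proof.
move=> x0; rewrite tauE//.
apply: near_eq_is_derive (is_derive_tau_pair j x0).
by near=> y; rewrite tauE//; near: y; exact: near_neq0.
Unshelve. all: by end_near. Qed.

Lemma tau_rec_neq0 j (x : R) : x != 0 ->
  x ^+ 2 * tau j.+2 x = tau j x + (j.*2.+1)%:R * tau j.+1 x.
Proof. by move=> x0; rewrite !tauE// tau_pair_rec. Qed.

End bessel_recurrence.

(** * The algebraic identity between consecutive binomial sums *)

Section bessel_sum.
Context {F : fieldType}.
Variables (a b : F) (k t : nat -> F).
Hypothesis krec : forall j, a * k j.+2 = k j + (j.*2.+1)%:R * k j.+1.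
Hypothesis trec : forall j, b * t j.+2 = t j + (j.*2.+1)%:R * t j.+1.

Definition bessel_sum p := \sum_(i < p.+1) 'C(p, i)%:R * (a ^+ i * k (p + i)%N * t i).
(** For [a = x ^+ 2] and [b = y ^+ 2], [bessel_sum_dl] and [bessel_sum_dr] are [- 1 / x] and
    [- 1 / y] times the partial derivatives of [bessel_sum] in [x] and [y]. *)
Definition bessel_sum_dl p := \sum_(i < p.+1) 'C(p, i)%:R *
  ((a ^+ i * k (p + i).+1 - i.*2%:R * a ^+ i.-1 * k (p + i)%N) * t i).
Definition bessel_sum_dr p := \sum_(i < p.+1) 'C(p, i)%:R * (a ^+ i * k (p + i)%N * t i.+1).

Lemma sum_binS q (X : nat -> F) : \sum_(i < q.+2) 'C(q.+1, i)%:R * X i =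
  \sum_(i < q.+1) 'C(q, i)%:R * (X i + X i.+1).
Proof.
rewrite big_ord_recl/= bin0 mul1r.
under eq_bigr do rewrite /bump leq0n add1n binS natrD mulrDl.
rewrite big_split/= addrA.
under [RHS]eq_bigr do rewrite mulrDr.
rewrite [RHS]big_split/=; congr (_ + _).
rewrite [RHS]big_ord_recl/= bin0 mul1r; congr (_ + _).
by rewrite big_ord_recr/= bin_small// mul0r addr0.
Qed.

(** By [(q - i) * 'C(q, i) = (i + 1) * 'C(q, i.+1)]. *)
Lemma sum_bin_shift q (E : nat -> F) :
  \sum_(i < q.+1) 'C(q, i)%:R * ((q%:R - i%:R) * E i.+1) =
  \sum_(i < q.+1) 'C(q, i)%:R * (i%:R * E i).
Proof.
rewrite [RHS]big_ord_recl/= mulr0n mul0r mulr0 add0r big_ord_recr/= subrr mul0r mulr0 addr0.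
apply: eq_bigr => i _; rewrite /bump leq0n add1n !mulrA; congr (_ * _).
rewrite -natrB; last exact/ltnW/ltn_ord.
by rewrite -!natrM mulnC -mul_bin_left mulnC.
Qed.

(** Pascal's rule puts every sum on the weights ['C(q, i)]; the terms then differ by
    [2 a ((q - i) E i.+1 - i E i)], whose weighted sum vanishes by [sum_bin_shift]. For [a = r^2],
    [b = s^2] this is the differential equation of [T_p], multiplied by [r^2 - s^2]. *)
Lemma bessel_sum_rec q : (q.*2.+1)%:R * (a - b) * bessel_sum q.+1 +
  a * b * (bessel_sum_dl q.+1 - bessel_sum_dr q.+1) = - (a - b) * bessel_sum q.
Proof.
rewrite /bessel_sum_dl /bessel_sum_dr /bessel_sum.
rewrite (sum_binS q (fun i => a ^+ i * k (q.+1 + i)%N * t i)).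
rewrite (sum_binS q (fun i => (a ^+ i * k (q.+1 + i).+1 -
  i.*2%:R * a ^+ i.-1 * k (q.+1 + i)%N) * t i)).
rewrite (sum_binS q (fun i => a ^+ i * k (q.+1 + i)%N * t i.+1)).
pose E i := a ^+ i * k (q.+1 + i)%N * t i.
have Z i : (q.*2.+1)%:R * (a - b) * (E i + E i.+1) +
  a * b * ((a ^+ i * k (q.+1 + i).+1 - i.*2%:R * a ^+ i.-1 * k (q.+1 + i)%N) * t i +
   (a ^+ i.+1 * k (q.+1 + i.+1).+1 - i.+1.*2%:R * a ^+ i * k (q.+1 + i.+1)%N) * t i.+1 -
   (a ^+ i * k (q.+1 + i)%N * t i.+1 + a ^+ i.+1 * k (q.+1 + i.+1)%N * t i.+2)) +
  (a - b) * (a ^+ i * k (q + i)%N * t i) =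
  2 * a * ((q%:R - i%:R) * E i.+1 - i%:R * E i).
  (* Carrying the factor [a] inside replaces the truncated exponent [i.-1] by [i]; at [i = 0] its
     coefficient is 0. *)
  have -> : a * b * ((a ^+ i * k (q.+1 + i).+1 -
      i.*2%:R * a ^+ i.-1 * k (q.+1 + i)%N) * t i +
    (a ^+ i.+1 * k (q.+1 + i.+1).+1 -
      i.+1.*2%:R * a ^+ i * k (q.+1 + i.+1)%N) * t i.+1 -
   (a ^+ i * k (q.+1 + i)%N * t i.+1 + a ^+ i.+1 * k (q.+1 + i.+1)%N * t i.+2)) =
    b * ((a ^+ i.+1 * k (q.+1 + i).+1 - i.*2%:R * a ^+ i * k (q.+1 + i)%N) * t i +
   (a ^+ i.+2 * k (q.+1 + i.+1).+1 - i.+1.*2%:R * a ^+ i.+1 * k (q.+1 + i.+1)%N) * t i.+1 -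
   (a ^+ i.+1 * k (q.+1 + i)%N * t i.+1 + a ^+ i.+2 * k (q.+1 + i.+1)%N * t i.+2)).
    by case: i => [|i] /=; rewrite ?double0 !exprS; ring.
  rewrite /E !addSn !addnS.
  (* Solving the recurrences for the lowest indices expresses everything through [k (q + i).+2],
     [k (q + i).+3], [t i.+1] and [t i.+2], without division. *)
  have e1 := krec (q + i); have e2 := krec (q + i).+1; have e3 := trec i.
  have -> : k (q + i)%N = a * k (q + i).+2 - ((q + i).*2.+1)%:R * k (q + i).+1.
    by rewrite e1 addrK.
  have -> : t i = b * t i.+2 - (i.*2.+1)%:R * t i.+1 by rewrite e3 addrK.
  have -> : k (q + i).+1 = a * k (q + i).+3 - ((q + i).+1.*2.+1)%:R * k (q + i).+2.
    by rewrite e2 addrK.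
  have D n : n.*2%:R = 2 * n%:R :> F by rewrite -mul2n natrM.
  have S n : n.+1%:R = n%:R + 1 :> F by rewrite natr1.
  by rewrite !exprS !(S, D) !natrD; ring.
apply/eqP; rewrite -subr_eq0 mulNr opprK; apply/eqP.
rewrite !mulr_sumr -!sumrB mulr_sumr -!big_split/=.
transitivity (2 * a * (\sum_(i < q.+1) 'C(q, i)%:R * ((q%:R - i%:R) * E i.+1) -
    \sum_(i < q.+1) 'C(q, i)%:R * (i%:R * E i))).
  rewrite -sumrB mulr_sumr; apply: eq_bigr => i _.
  transitivity ('C(q, i)%:R * (2 * a * ((q%:R - i%:R) * E i.+1 - i%:R * E i)));
    last by ring.
  by rewrite -Z /E; ring.
by rewrite sum_bin_shift subrr mulr0.
Qed.

End bessel_sum.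

(** * Continuity and recurrence of [tau] at the origin *)

Section tau_zero.
Context {R : realType}.

(** L'Hopital's rule for [tau j.+1 = f / g] with [g = y ^+ (2 j + 1)]: by the recurrence the
    derivative of [f] is [- tau j y * y ^+ (2 j)], so the quotient of derivatives is
    [- tau j / (2 j + 1)]. *)
Lemma tau_step j : {for (0 : R), continuous (tau j)} ->
  (fun y : R => y ^+ j.*2.+1 * tau j.+1 y) @ (0 : R) --> (0 : R) ->
  {for (0 : R), continuous (tau j.+1)} /\
  tau j (0 : R) = - (j.*2.+1)%:R * tau j.+1 (0 : R).
Proof.
move=> ct f0; set c : R := (j.*2.+1)%:R.
have c0 : c != 0 by rewrite pnatr_eq0.
pose f (y : R) := y ^+ j.*2.+1 * tau j.+1 y.
pose df (y : R) := - tau j y * y ^+ j.*2.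
pose g (y : R) := y ^+ j.*2.+1.
pose dg (y : R) := c * y ^+ j.*2.
pose l := - tau j (0 : R) / c.
have fdf (x : R) : x != 0 -> is_derive x (1 : R) f (df x).
  move=> x0.
  apply: (is_derive_eq (is_deriv1M (is_deriv1X j.*2.+1 (is_deriv1_id x))
    (is_derive_tau j.+1 x0))).
  have := tau_rec_neq0 j x0; rewrite -/c => e.
  rewrite /df.
  have -> : tau j x = x ^+ 2 * tau j.+2 x - c * tau j.+1 x by rewrite e addrK.
  rewrite -/c -pred_Sn exprS.
  move: (tau j.+1 x) (tau j.+2 x) (x ^+ j.*2) => u v X; generalize c => d; ring.
have gdg (x : R) : is_derive x (1 : R) g (dg x).
  apply: (is_derive_eq (is_deriv1X j.*2.+1 (is_deriv1_id x))).
  by rewrite /dg mulr1.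
have g0 : g @ (0 : R) --> (0 : R).
  have e0 : g 0 = 0 by rewrite /g exprS mul0r.
  by rewrite -[X in _ --> X]e0; exact: is_deriv1_continuous (gdg 0).
have rat (x : R) : x != 0 -> df x / dg x = - tau j x / c.
  by move=> x0; rewrite /df /dg -mulf_div divff ?mulr1// expf_neq0.
have crat : (fun x : R => - tau j x / c) @ (0 : R) --> l.
  by apply: cvgM; [exact: cvgN|exact: cvg_cst].
have ctn : tau j.+1 @ (0 : R)^' --> l.
  have : (fun x => f x / g x) @ (0 : R)^' --> l.
    apply/(@cvg_at_right_left_dnbhs _ R^o).
      apply: (@lhopital_at_right R f df g dg 0 1 l ltr01).
      - move=> x; rewrite in_itv/= => /andP[x0 _].
        by apply: fdf; rewrite gt_eqF.
      - exact: cvg_at_right_filter f0.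
      - exact: cvg_at_right_filter g0.
      - move=> x; rewrite in_itv/= => /andP[x0 _].
        by rewrite mulf_neq0// expf_neq0// gt_eqF.
      - apply: cvg_trans (cvg_at_right_filter crat); apply: near_eq_cvg.
        near=> x; rewrite rat// gt_eqF//; near: x; exact: nbhs_right_gt.
    apply: (@lhopital_at_left R f df g dg (-1) 0 l (ltrN10 _)).
    - move=> x; rewrite in_itv/= => /andP[_ x0].
      by apply: fdf; rewrite lt_eqF.
    - exact: cvg_at_left_filter f0.
    - exact: cvg_at_left_filter g0.
    - move=> x; rewrite in_itv/= => /andP[_ x0].
      by rewrite mulf_neq0// expf_neq0// lt_eqF.
    - apply: cvg_trans (cvg_at_left_filter crat); apply: near_eq_cvg.
      near=> x; rewrite rat// lt_eqF//; near: x; exact: nbhs_left_lt.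
  apply: cvg_trans; apply: near_eq_cvg; near=> x.
  have x0 : x != 0 by near: x; exact: nbhs_dnbhs_neq.
  by rewrite /f /g mulrC mulrA mulVf ?mul1r// expf_neq0.
(* At 0 the value is by definition the limit of the expression that defines [tau j.+1] elsewhere. *)
have tl : tau j.+1 (0 : R) = l.
  rewrite /= eqxx/=; apply: cvg_lim => //.
  apply: cvg_trans ctn; apply: near_eq_cvg; near=> x.
  have x0 : x != 0 by near: x; exact: nbhs_dnbhs_neq.
  by rewrite /= x0.
split; last by rewrite tl /l; field.
by apply/continuous_withinNx; rewrite tl.
Unshelve. all: by end_near. Qed.

(** The numerator [y ^+ (2 j + 3) * tau j.+2 y] equals [y ^+ (2 j + 1) * (tau j y + (2 j + 1) * tau
    j.+1 y)], which tends to 0 once two consecutive [tau] are continuous; hence the induction on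
    pairs. *)
Lemma tau_zero j : [/\ {for (0 : R), continuous (tau j)},
  {for (0 : R), continuous (tau j.+1)} &
  tau j (0 : R) = - (j.*2.+1)%:R * tau j.+1 (0 : R)].
Proof.
elim: j => [|j [c0 c1 e]].
  have c0 : {for (0 : R), continuous (tau 0)}.
    exact: is_deriv1_continuous (is_derive_cosh 0).
  suff /(tau_step c0)[] :
    (fun y : R => y ^+ 0.*2.+1 * tau 1 y) @ (0 : R) --> (0 : R) by split.
  have -> : (fun y : R => y ^+ 0.*2.+1 * tau 1 y) = fun y => - sinh y.
    apply/funext => y; rewrite double0 expr1.
    have [->|y0] := eqVneq y 0; first by rewrite mul0r /sinh oppr0 subrr mul0r oppr0.
    by rewrite tauE//=; field.
  have sd := is_deriv1_continuous (is_deriv1N (is_derive_sinh (0 : R))).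
  suff {2}-> : (0 : R) = - sinh 0 by exact: sd.
  by rewrite /sinh oppr0 subrr mul0r oppr0.
suff /(tau_step c1)[] :
  (fun y : R => y ^+ j.+1.*2.+1 * tau j.+2 y) @ (0 : R) --> (0 : R) by split.
have -> : (fun y : R => y ^+ j.+1.*2.+1 * tau j.+2 y) =
    fun y => y ^+ j.*2.+1 * (tau j y + (j.*2.+1)%:R * tau j.+1 y).
  apply/funext => y; have [->|y0] := eqVneq y 0; first by rewrite !exprS !mul0r.
  rewrite -tau_rec_neq0// doubleS !exprS; move: (tau j.+2 y) => u; ring.
have cx := is_deriv1_continuous (is_deriv1X j.*2.+1 (is_deriv1_id (0 : R))).
rewrite [X in _ --> X](_ : (0 : R) = 0 ^+ j.*2.+1 *
  (tau j 0 + (j.*2.+1)%:R * tau j.+1 0)); last by rewrite exprS !mul0r.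
apply: cvgM; first exact: cx.
by apply: cvgD; [exact: c0|apply: cvgM; [exact: cvg_cst|exact: c1]].
Qed.

Lemma continuous_tau j (x : R) : {for x, continuous (tau j)}.
Proof.
have [->|x0] := eqVneq x 0; first by have [] := tau_zero j.
exact: is_deriv1_continuous (is_derive_tau j x0).
Qed.

Lemma tau_rec j (x : R) : x ^+ 2 * tau j.+2 x = tau j x + (j.*2.+1)%:R * tau j.+1 x.
Proof.
have [->|x0] := eqVneq x 0; last exact: tau_rec_neq0.
by have [_ _ ->] := tau_zero j; rewrite expr0n mul0r mulNr addNr.
Qed.

End tau_zero.

(** * The primitives along r^2 + s^2 = m *)

Section curve.
Context {R : realType}.
Local Notation mu := (@lebesgue_measure R).

Lemma is_deriv1_sum n (h : nat -> R -> R) (dh : nat -> R) (x : R) :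
  (forall i, is_derive x (1 : R) (h i) (dh i)) ->
  is_derive x (1 : R) (fun y => \sum_(i < n) h i y) (\sum_(i < n) dh i).
Proof.
move=> hd; elim: n => [|n IH].
  rewrite big_ord0 (_ : (fun _ => _) = fun=> 0); first exact: is_deriv1_cst.
  by apply/funext => y; rewrite big_ord0.
rewrite big_ord_recr (_ : (fun _ => _) = fun y => \sum_(i < n) h i y + h n y).
  exact: is_deriv1D IH (hd n).
by apply/funext => y; rewrite big_ord_recr.
Qed.

Definition kt_sum (p : nat) (x y : R) : R :=
  bessel_sum (x ^+ 2) (fun j => kap j x) (fun j => tau j y) p.

Lemma kt_sum_rec q (x y : R) : x != 0 ->
  (q.*2.+1)%:R * (x ^+ 2 - y ^+ 2) * kt_sum q.+1 x y + x ^+ 2 * y ^+ 2 *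
    (bessel_sum_dl (x ^+ 2) (fun j => kap j x) (fun j => tau j y) q.+1 -
     bessel_sum_dr (x ^+ 2) (fun j => kap j x) (fun j => tau j y) q.+1) =
  - (x ^+ 2 - y ^+ 2) * kt_sum q x y.
Proof.
by move=> x0; apply: bessel_sum_rec => j; [exact: kap_rec|exact: tau_rec].
Qed.

Lemma is_derive_kt_sum p (u v : R -> R) (z du dv : R) : u z != 0 -> v z != 0 ->
  is_derive z (1 : R) u du -> is_derive z (1 : R) v dv ->
  is_derive z (1 : R) (fun y => kt_sum p (u y) (v y))
   (- (du * u z * bessel_sum_dl (u z ^+ 2) (fun j => kap j (u z)) (fun j => tau j (v z)) p
     + dv * v z * bessel_sum_dr (u z ^+ 2) (fun j => kap j (u z)) (fun j => tau j (v z)) p)).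
Proof.
move=> u0 v0 hu hv.
pose h i y := 'C(p, i)%:R * (((u y) ^+ 2) ^+ i * kap (p + i) (u y) * tau i (v y)).
have dh i := is_deriv1M (is_deriv1_cst 'C(p, i)%:R z) (is_deriv1M (is_deriv1M
  (is_deriv1X i (is_deriv1X 2 hu))
  (is_deriv1_comp (f := kap (p + i)) (g := u) (is_derive_kap (p + i) u0) hu))
  (is_deriv1_comp (f := tau i) (g := v) (is_derive_tau i v0) hv)).
apply: (is_derive_eq (is_deriv1_sum p.+1 (h := h) dh)).
rewrite /bessel_sum_dl /bessel_sum_dr !mulr_sumr -big_split/= -sumrN.
apply: eq_bigr => i _; rewrite mul0r add0r expr1 -mul2n natrM.
move: (u z ^+ 2 ^+ i) (u z ^+ 2 ^+ i.-1) => A B.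
move: (kap (p + i) (u z)) (kap (p + i).+1 (u z)) => k0 k1.
move: (tau i (v z)) (tau i.+1 (v z)) => t0 t1; ring.
Qed.

Lemma continuous_kt_sum p (u v : R -> R) (z : R) : u z != 0 ->
  {for z, continuous u} -> {for z, continuous v} ->
  {for z, continuous (fun y => kt_sum p (u y) (v y))}.
Proof.
move=> u0 cu cv.
have ck j : {for z, continuous (fun y => kap j (u y))}.
  exact: (@continuous_comp R R R u (kap j) z cu
    (is_deriv1_continuous (is_derive_kap j u0))).
have ct j : {for z, continuous (fun y => tau j (v y))}.
  exact: (@continuous_comp R R R v (tau j) z cv (@continuous_tau R j (v z))).
have cX j : {for z, continuous (fun y => (u y ^+ 2) ^+ j)}.
  exact: (@continuous_comp R R R u (fun y => (y ^+ 2) ^+ j) z cu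
    (is_deriv1_continuous (is_deriv1X j (is_deriv1X 2 (is_deriv1_id (u z)))))).
rewrite /kt_sum /bessel_sum; move: p.+1 => n.
elim: n => [|n IH].
  rewrite (_ : (fun _ => _) = fun=> 0); first exact: cvg_cst.
  by apply/funext => y; rewrite big_ord0.
rewrite (_ : (fun _ => _) = fun y =>
  \sum_(i < n) 'C(p, i)%:R * ((u y ^+ 2) ^+ i * kap (p + i) (u y) * tau i (v y))
  + 'C(p, n)%:R * ((u y ^+ 2) ^+ n * kap (p + n) (u y) * tau n (v y))); last first.
  by apply/funext => y; rewrite big_ord_recr.
apply: cvgD; first exact: IH.
apply: cvgM; first exact: cvg_cst.
apply: cvgM; last exact: ct.
apply: cvgM; [exact: cX|exact: ck].
Qed.

Definition half_sum (m y : R) : R := (Num.sqrt (m + y) + Num.sqrt (m - y)) / 2.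
Definition half_dif (m y : R) : R := (Num.sqrt (m + y) - Num.sqrt (m - y)) / 2.

(* [r = half_sum m y] and [s = half_dif m y] solve [r^2 + s^2 = m] and
   [2 r s = y]: along this curve the sphere integral is an iterated primitive. *)
Definition curve (m : R) (j : nat) (y : R) : R :=
  (- 2) ^+ j.+1 * y ^+ j.*2.+1 * kt_sum j.+1 (half_sum m y) (half_dif m y).

Definition two_exp (m y : R) : R :=
  expR (- Num.sqrt (m + y)) + expR (- Num.sqrt (m - y)).

Section fixed_m.
Variable m : R.

Lemma half_sum_gt0 y : - m < y < m -> 0 < half_sum m y.
Proof.
move=> /andP[y1 y2]; rewrite /half_sum divr_gt0// addr_gt0// sqrtr_gt0; lra.
Qed.

Lemma is_derive_sqrtD y : - m < y < m ->
  is_derive y (1 : R) (fun y => Num.sqrt (m + y)) ((2 * Num.sqrt (m + y))^-1).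
Proof.
move=> /andP[y1 y2]; have h : 0 < m + y by lra.
have d := is_deriv1D (is_deriv1_cst m y) (is_deriv1_id y).
apply: (is_derive_eq (is_deriv1_sqrt (f := fun y => m + y) h d)).
by rewrite add0r mul1r.
Qed.

Lemma is_derive_sqrtB y : - m < y < m ->
  is_derive y (1 : R) (fun y => Num.sqrt (m - y)) (- (2 * Num.sqrt (m - y))^-1).
Proof.
move=> /andP[y1 y2]; have h : 0 < m - y by lra.
have d := is_deriv1D (is_deriv1_cst m y) (is_deriv1N (is_deriv1_id y)).
apply: (is_derive_eq (is_deriv1_sqrt (f := fun y => m - y) h d)).
by rewrite add0r mulN1r.
Qed.

Lemma is_derive_half_sum y : - m < y < m -> is_derive y (1 : R) (half_sum m)
  (((2 * Num.sqrt (m + y))^-1 - (2 * Num.sqrt (m - y))^-1) / 2).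
Proof.
move=> hy; apply: (is_derive_eq (is_deriv1M (is_deriv1D (is_derive_sqrtD hy)
  (is_derive_sqrtB hy)) (is_deriv1_cst 2^-1 y))).
by rewrite mulr0 addr0.
Qed.

Lemma is_derive_half_dif y : - m < y < m -> is_derive y (1 : R) (half_dif m)
  (((2 * Num.sqrt (m + y))^-1 + (2 * Num.sqrt (m - y))^-1) / 2).
Proof.
move=> hy; apply: (is_derive_eq (is_deriv1M (is_deriv1D (is_derive_sqrtD hy)
  (is_deriv1N (is_derive_sqrtB hy))) (is_deriv1_cst 2^-1 y))).
by rewrite mulr0 addr0 opprK.
Qed.

Lemma continuous_curve j y : - m < y < m -> {for y, continuous (curve m j)}.
Proof.
move=> hy; apply: cvgM.
  apply: (is_deriv1_continuous (f := fun y => (- 2) ^+ j.+1 * y ^+ j.*2.+1)).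
  exact: is_deriv1M (is_deriv1_cst _ _) (is_deriv1X _ (is_deriv1_id y)).
apply: continuous_kt_sum; first by rewrite gt_eqF// half_sum_gt0.
- exact: is_deriv1_continuous (is_derive_half_sum hy).
- exact: is_deriv1_continuous (is_derive_half_dif hy).
Qed.

Lemma continuous_two_exp y : - m < y < m -> {for y, continuous (two_exp m)}.
Proof.
move=> hy; apply: cvgD.
  exact: is_deriv1_continuous (is_deriv1_comp (f := fun x => expR (- x))
    (g := fun y => Num.sqrt (m + y)) (is_derive_expRN _) (is_derive_sqrtD hy)).
exact: is_deriv1_continuous (is_deriv1_comp (f := fun x => expR (- x))
  (g := fun y => Num.sqrt (m - y)) (is_derive_expRN _) (is_derive_sqrtB hy)).
Qed.

(** Differentiating [r^2 + s^2 = m] and [2 r s = y] gives [y T' = r^2 s^2 (DL - DR) / (r^2 - s^2)],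
    so [kt_sum_rec] reads [(2 j + 1) T_(j+1) + y T_(j+1)' = - T_j]. The condition [0 < y] keeps [s]
    nonzero. *)
Lemma is_derive_curve j y : 0 < y < m -> is_derive y (1 : R) (curve m j)
  (- (- 2) ^+ j.+1 * y ^+ j.*2 * kt_sum j (half_sum m y) (half_dif m y)).
Proof.
move=> /andP[y0 ym].
have hy : - m < y < m by rewrite ym andbT; lra.
have a0 : 0 < Num.sqrt (m + y) by rewrite sqrtr_gt0; lra.
have b0 : 0 < Num.sqrt (m - y) by rewrite sqrtr_gt0; lra.
have ab : Num.sqrt (m - y) < Num.sqrt (m + y) by rewrite ltr_sqrt; lra.
have a2 : Num.sqrt (m + y) ^+ 2 = m + y by rewrite sqr_sqrtr; lra.
have b2 : Num.sqrt (m - y) ^+ 2 = m - y by rewrite sqr_sqrtr; lra.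
have r0 := half_sum_gt0 hy.
have s0 : 0 < half_dif m y by rewrite /half_dif divr_gt0// subr_gt0.
have rn : half_sum m y != 0 by rewrite gt_eqF.
have sn : half_dif m y != 0 by rewrite gt_eqF.
have dT := is_derive_kt_sum j.+1 rn sn (is_derive_half_sum hy) (is_derive_half_dif hy).
apply: (is_derive_eq (is_deriv1M (is_deriv1M (is_deriv1_cst _ y)
  (is_deriv1X j.*2.+1 (is_deriv1_id y))) dT)).
have := kt_sum_rec j (half_dif m y) rn.
move: (bessel_sum_dl _ _ _ _) (bessel_sum_dr _ _ _ _) (kt_sum j.+1 _ _) (kt_sum j _ _).
move=> DL DR T1 T0.
have [rE sE] : half_sum m y = (Num.sqrt (m + y) + Num.sqrt (m - y)) / 2 /\
  half_dif m y = (Num.sqrt (m + y) - Num.sqrt (m - y)) / 2 by [].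
have yE : y = (Num.sqrt (m + y) ^+ 2 - Num.sqrt (m - y) ^+ 2) / 2.
  by rewrite a2 b2; field.
rewrite rE sE mul0r add0r mulr1 -pred_Sn.
move: (Num.sqrt (m + y)) (Num.sqrt (m - y)) a0 b0 ab yE => a b a0 b0 ab yE.
have an : a != 0 by rewrite gt_eqF.
have bn : b != 0 by rewrite gt_eqF.
move=> E.
(* With [a] and [b] the square roots of [m + y] and [m - y], [r^2 - s^2 = a b] and
   [r s = (a^2 - b^2) / 4]. *)
have {}E : (j.*2.+1)%:R * T1 * (a * b) + (((a ^+ 2 - b ^+ 2) / 4) ^+ 2) * (DL - DR) =
    - T0 * (a * b).
  have e1 : ((a + b) / 2) ^+ 2 - ((a - b) / 2) ^+ 2 = a * b by field.
  have e2 : ((a + b) / 2) ^+ 2 * ((a - b) / 2) ^+ 2 = ((a ^+ 2 - b ^+ 2) / 4) ^+ 2.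
    by field.
  by move: E; rewrite e1 e2 => E; rewrite mulrAC E; ring.
have T0E : T0 = - ((j.*2.+1)%:R * T1 +
    (((a ^+ 2 - b ^+ 2) / 4) ^+ 2) * (DL - DR) / (a * b)).
  have -> : (j.*2.+1)%:R * T1 + (((a ^+ 2 - b ^+ 2) / 4) ^+ 2) * (DL - DR) / (a * b) =
    ((j.*2.+1)%:R * T1 * (a * b) + (((a ^+ 2 - b ^+ 2) / 4) ^+ 2) * (DL - DR)) / (a * b).
    by field; rewrite an bn.
  by rewrite E; field; rewrite an bn.
rewrite T0E {T0E E} !exprS.
move: (y ^+ j.*2) ((- 2) ^+ j) ((j.*2.+1)%:R) => Z M c.
by rewrite yE; field; rewrite an bn.
Qed.

End fixed_m.

Lemma kt_sum0 (x y : R) : kt_sum 0 x y = expR (- x) * cosh y.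
Proof.
by rewrite /kt_sum /bessel_sum big_ord1 /kap /chi/= addn0 expr0 bin0 divr1 !mulr1 !mul1r.
Qed.

(** For [m = r^2 + s^2] and [Y = 2 r s], [m + Y] and [m - Y] are the squares of [r + s] and [r - s],
    so the curve passes through [(r, s)] at [Y]; [s < r] ensures [Y < m]. *)
Lemma curve_integral q (r s : R) : 0 < s < r ->
  (\int[mu]_(t in `[0%R, +oo[)
     (hyp t ^- q.*2.+3 * two_exp (r ^+ 2 + s ^+ 2) (2 * r * s * (t / hyp t)))%:E)%E =
  (q`!%:R * (- 2) ^+ q.+1 * kt_sum q.+1 r s)%:E.
Proof.
move=> /andP[s0 sr].
set m := r ^+ 2 + s ^+ 2; set Y := 2 * r * s.
have Y0 : 0 < Y by rewrite /Y; nra.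
have Ym : Y < m by rewrite /Y /m; nra.
have -> : (q`!%:R * (- 2) ^+ q.+1 * kt_sum q.+1 r s) =
    q`!%:R * Y ^- q.*2.+1 * curve m q Y.
  rewrite /curve; have -> : half_sum m Y = r.
    have -> : half_sum m Y = (Num.sqrt ((r + s) ^+ 2) + Num.sqrt ((r - s) ^+ 2)) / 2.
      by rewrite /half_sum; congr ((Num.sqrt _ + Num.sqrt _) / 2); rewrite /m /Y; ring.
    rewrite !sqrtr_sqr !gtr0_norm; [by field|lra|lra].
  have -> : half_dif m Y = s.
    have -> : half_dif m Y = (Num.sqrt ((r + s) ^+ 2) - Num.sqrt ((r - s) ^+ 2)) / 2.
      by rewrite /half_dif; congr ((Num.sqrt _ - Num.sqrt _) / 2); rewrite /m /Y; ring.
    rewrite !sqrtr_sqr !gtr0_norm; [by field|lra|lra].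
  have Yq : Y ^+ q.*2.+1 != 0 by rewrite expf_neq0 ?gt_eqF.
  by field.
apply: (@angular_integral R q m Y (curve m)).
- by rewrite Y0.
- by move=> y _; rewrite addr_ge0 ?expR_ge0.
- exact: continuous_two_exp.
- by move=> j y; exact: continuous_curve.
- by move=> j; rewrite /curve [0 ^+ _]exprS mul0r mulr0 mul0r.
(* The first primitive: [2 exp (- r) cosh s = exp (- (r + s)) + exp (- (r - s))]. *)
- move=> y hy; apply: (is_derive_eq (is_derive_curve 0 hy)).
  rewrite kt_sum0 double0 expr0 /cosh /two_exp.
  have -> : Num.sqrt (m + y) = half_sum m y + half_dif m y.
    by rewrite /half_sum /half_dif; field.
  have -> : Num.sqrt (m - y) = half_sum m y - half_dif m y.
    by rewrite /half_sum /half_dif; field.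
  rewrite expr1 opprK opprD opprB [expR (- _ - _)]expRD [expR (_ - half_sum _ _)]expRD.
  by field.
- move=> j y hy; apply: (is_derive_eq (is_derive_curve j.+1 hy)).
  by rewrite /curve doubleS !exprS; ring.
Qed.

(** Equals [2 ^+ q.+1] over the product of the odd numbers up to [2 q + 1]: the coefficients of the
    iterated primitives of the constant 2. *)
Definition beta (q : nat) : R := 4 ^+ q.+1 * (q.+1)`!%:R / (q.+1.*2)`!%:R.

Lemma beta_rec q : beta q.+1 * (q.*2.+3)%:R = 2 * beta q.
Proof.
rewrite /beta !doubleS [(_.+1)`!]factS [in X in X / _]factS !factS !natrM.
have n0 n : n`!%:R != 0 :> R by rewrite pnatr_eq0 -lt0n fact_gt0.
have s0 n : n.+1%:R != 0 :> R by rewrite pnatr_eq0.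
have e : (q.*2.+4)%:R = 2 * q.+2%:R :> R by rewrite -natrM mul2n !doubleS.
rewrite e !exprS; field.
by rewrite n0 !gt_eqF ?ltr_wpDr ?ler0n.
Qed.

Lemma hyp_integral q : (\int[mu]_(t in `[0%R, +oo[)
  (hyp t ^- q.*2.+3 * 2)%:E)%E = (q`!%:R * beta q)%:E.
Proof.
etransitivity.
  apply: (@angular_integral R q 2 1 (fun j y => beta j * y ^+ j.*2.+1) (fun=> 2)).
  - lra.
  - by move=> *.
  - by move=> *; exact: cvg_cst.
  - move=> j y _; apply: is_deriv1_continuous.
    exact: is_deriv1M (is_deriv1_cst _ _) (is_deriv1X _ (is_deriv1_id y)).
  - by move=> j; rewrite exprS mul0r mulr0.
  - move=> y _; apply: (is_derive_eq (is_deriv1M (is_deriv1_cst (beta 0) y)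
      (is_deriv1X 1 (is_deriv1_id y)))).
    rewrite mul0r add0r expr0 !mulr1 /beta (_ : 1.*2 = 2)%N//.
    by rewrite expr1 !factS fact0 muln1; field.
  - move=> j y _; apply: (is_derive_eq (is_deriv1M (is_deriv1_cst (beta j.+1) y)
      (is_deriv1X j.+1.*2.+1 (is_deriv1_id y)))).
    rewrite mul0r add0r mulr1 -pred_Sn doubleS mulrA beta_rec.
    by rewrite !exprS; ring.
by rewrite !expr1n invr1 !mulr1.
Qed.

(** At [y = 0] the derivative terms drop out of [kt_sum_rec], leaving [(2 i + 1) T_(i+1) = - T_i],
    so [(- 2) ^+ q.+1 * T_(q+1)] obeys the recurrence of [beta]. This covers [s = 0], which
    [curve_integral] excludes. *)
Lemma kt_sum_at0 q (x : R) : x != 0 ->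
  (- 2) ^+ q.+1 * kt_sum q.+1 x 0 = beta q * expR (- x).
Proof.
move=> x0.
have step i : (i.*2.+1)%:R * kt_sum i.+1 x 0 = - kt_sum i x 0.
  have := kt_sum_rec i 0 x0; rewrite expr0n/= subr0 mulr0 mul0r addr0.
  move=> E; apply: (mulfI (expf_neq0 2 x0)).
  by rewrite mulrCA mulrA E mulNr mulrN.
elim: q => [|q IH].
  have := step 0%N; rewrite double0 mul1r kt_sum0 => ->.
  rewrite /cosh oppr0 expR0 /beta (_ : 1.*2 = 2)%N// !expr1 !factS fact0 muln1.
  by field.
have n0 : (q.*2.+3)%:R != 0 :> R by rewrite pnatr_eq0.
apply: (mulfI n0).
rewrite mulrA [RHS]mulrA [X in _ = X * _]mulrC beta_rec -[RHS]mulrA -IH.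
have := step q.+1; rewrite doubleS => e.
by rewrite [_ * (- 2) ^+ _]mulrC -mulrA e [in LHS]exprS; ring.
Qed.

End curve.

(** * The sphere integral *)

Section sphere.
Context {R : realType}.
Local Notation mu := (@lebesgue_measure R).

(** Law of cosines: [exp (- |r u - s|)] for a unit vector [u] whose scalar product with [s] is [y],
    where [S = |s|]. *)
Definition dist_exp (r S y : R) : R := expR (- Num.sqrt (r ^+ 2 + S ^+ 2 - 2 * r * y)).

Lemma measurable_dist_exp r S : measurable_fun [set: R] (dist_exp r S).
Proof.
apply: (measurableT_comp (@measurable_expR R)).
apply: (measurableT_comp (@oppr_measurable R _)).
by mfun; exact: (@measurable_funM _ _ _ _ (cst (2 * r)) id).
Qed.

Lemma sqr_eucl_norm n (s : n.-tuple R) : eucl_norm s ^+ 2 = sqn s.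
Proof. by rewrite sqr_sqrtr// sqn_ge0. Qed.

Lemma eucl_dist_scale n (c : R) (x s : n.-tuple R) :
  eucl_dist (tscale c x) s = Num.sqrt (c ^+ 2 * sqn x + sqn s - 2 * c * dotp x s).
Proof.
congr Num.sqrt; rewrite /sqn /dotp !mulr_sumr -big_split/= -sumrB.
by apply: eq_bigr => i _; rewrite tnth_map; ring.
Qed.

Lemma tscaleA n (c d : R) (x : n.-tuple R) : tscale c (tscale d x) = tscale (c * d) x.
Proof. by apply: eq_from_tnth => i; rewrite !tnth_map mulrA. Qed.

Lemma sphere_int_dist n (r : R) (s : n.-tuple R) :
  sphere_int r (fun x : n.-tuple R => (expR (- eucl_dist x s))%:E) =
  ((r ^+ n.-1)%:E * (n%:R%:E * lebint (fun x : n.-tuple R =>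
   (if (eucl_norm x < 1)%R then
      if sqn x == 0%R then expR (- eucl_norm s)
      else dist_exp r (eucl_norm s) (dotp x s / eucl_norm x)%R
    else 0%R)%:E)))%E.
Proof.
rewrite /sphere_int /unit_sphere_int; do 2 apply: congr1.
apply: (congr1 (@lebint R n)); apply/funext => x; case: ifP => // _.
congr EFin; rewrite tscaleA eucl_dist_scale /dist_exp sqr_eucl_norm.
(* At the origin [0^-1 = 0] sends the point to the centre of the sphere, at distance [|s|] from
   [s]. *)
case: eqP => [x0|/eqP x0].
  have -> : eucl_norm x = 0 by rewrite /eucl_norm -/(sqn x) x0 sqrtr0.
  by rewrite invr0 !mulr0 expr0n/= !mul0r add0r subr0.
have N0 : eucl_norm x != 0 by rewrite -(sqr_eucl_norm x) sqrf_eq0 in x0.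
by congr (expR (- Num.sqrt _)); rewrite -(sqr_eucl_norm x); field.
Qed.

(** Folding pairs [t] with [- t] and gives [two_exp]; for [S = 0] the integrand is [exp (- r)] times
    the bare weight. *)
Lemma angular_value q (r S : R) : 0 <= S < r ->
  (\int[mu]_t (hyp t ^- q.*2.+3 * dist_exp r S (S * (t / hyp t)))%:E)%E =
  (q`!%:R * (- 2) ^+ q.+1 * kt_sum q.+1 r S)%:E.
Proof.
move=> /andP[S0 Sr].
have mh := @measurable_hyp R; have md := measurable_dist_exp r S.
have h0 (t : R) : 0 <= hyp t ^- q.*2.+3 by rewrite invr_ge0 exprn_ge0// ltW// hyp_gt0.
rewrite ge0_integral_fold; [|by mfun|]; last first.
  by move=> t; rewrite lee_fin mulr_ge0 ?h0 ?expR_ge0.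
have hN (t : R) : hyp (- t) = hyp t by rewrite /hyp sqrrN.
move: S0; rewrite le_eqVlt => /predU1P[S0|S0]; last first.
  etransitivity; last by apply: curve_integral; rewrite S0.
  apply: eq_integral => t _.
  rewrite -EFinD hN -mulrDr /dist_exp /two_exp; congr (_ * _)%:E.
  by rewrite addrC; congr (expR (- Num.sqrt _) + expR (- Num.sqrt _)); ring.
have r0 : 0 < r by rewrite S0.
rewrite -mulrA -S0 kt_sum_at0 ?gt_eqF// mulrA mulrC EFinM -hyp_integral.
rewrite -ge0_integralZl//=; last 2 first.
- by apply: measurable_funTS; mfun.
- by move=> t _; rewrite lee_fin mulr_ge0 ?h0.
apply: eq_integral => t _; rewrite -EFinD -EFinM hN /dist_exp.
rewrite !mul0r !mulr0 subr0 expr0n addr0 sqrtr_sqr gtr0_norm//.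
by congr EFin; ring.
Qed.

Lemma hyp_integralT q :
  (\int[mu]_t (hyp t ^- q.*2.+3 * 1)%:E)%E = (q`!%:R * beta q : R)%:E.
Proof.
have mh := @measurable_hyp R.
have h0 (t : R) : 0 <= hyp t ^- q.*2.+3 by rewrite invr_ge0 exprn_ge0// ltW// hyp_gt0.
rewrite ge0_integral_fold; [|by mfun|]; last first.
  by move=> t; rewrite lee_fin mulr_ge0 ?h0.
rewrite -hyp_integral; apply: eq_integral => t _.
by rewrite -EFinD /hyp sqrrN -mulrDr.
Qed.

(** In dimension 1 the sphere is two points: up to a reflection, the integrand is [psi S] on the
    positive half of the ball and [psi (- S)] on the negative half. *)
Lemma lebint1_ball (s : 1.-tuple R) (psi : R -> R) (d : R) :
  measurable_fun [set: R] psi -> (forall y, 0 <= psi y) -> 0 <= d ->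
  lebint (fun x => (if (eucl_norm x < 1)%R then
      if sqn x == 0%R then d else psi (dotp x s / eucl_norm x)%R
    else 0%R)%:E) = (psi (eucl_norm s) + psi (- eucl_norm s))%:E.
Proof.
move=> mpsi psi0 d0; set S := eucl_norm s.
pose G (p : R * R) : \bar R := (if (Num.sqrt p.1 < 1)%R then
   if p.1 == 0%R then d else psi (p.2 / Num.sqrt p.1) else 0%R)%:E.
have mG : measurable_fun setT G.
  apply/measurable_EFinP; apply: measurable_fun_ifT; last by mfun.
    by apply: measurable_fun_ltr; mfun.
  apply: measurable_fun_ifT; [|by mfun|by mfun].
  by apply: measurable_fun_eqr; mfun.
have G0 p : (0 <= G p)%E by rewrite lee_fin; case: ifP => // _; case: ifP.
etransitivity; first exact: (lebint1 s mG G0).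
have mI (i : interval R) :
    measurable_fun [set: R] (fun x => (\1_[set` i] x : R)%:E).
  by apply/measurable_EFinP; exact: measurable_indic.
have mcI (c : R) (i : interval R) :
    measurable_fun [set: R] (fun x => c%:E * (\1_[set` i] x : R)%:E)%E.
  by apply: emeasurable_funM; [exact: measurable_cst|exact: mI].
pose I1 : interval R := Interval (BLeft 0) (BLeft 1).
pose I2 : interval R := Interval (BRight (-1)) (BLeft 0).
transitivity (\int[mu]_x ((psi S)%:E * (\1_[set` I1] x)%:E +
                          (psi (- S))%:E * (\1_[set` I2] x)%:E))%E.
  apply: eq_integral_neq0.
  - by mfun.
  - by apply: emeasurable_funD; exact: mcI.
  move=> x x0; rewrite /G/= -/S sqrtr_sqr sqrf_eq0 (negbTE x0) -!EFinM -EFinD.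
  congr EFin; rewrite !indicE.
  have -> : (x \in [set` I1]) = (0 <= x < 1) by rewrite mem_setE in_itv.
  have -> : (x \in [set` I2]) = (-1 < x < 0) by rewrite mem_setE in_itv.
  have [xp|xn] : 0 < x \/ x < 0 by case: (ltgtP x 0) x0; auto.
    rewrite gtr0_norm// (ltW xp) (lt_gtF xp) andbF mulr0 addr0 /=.
    by case: ifP => x1; rewrite ?mulr0 ?mulr1//; congr psi; field.
  rewrite ltr0_norm// (lt_geF xn) xn andbT mulr0 add0r ltrNl.
  by case: ifP => x1; rewrite ?mulr0 ?mulr1//; congr psi; field.
rewrite ge0_integralD//=; last 4 first.
- by move=> x _; rewrite mule_ge0 ?lee_fin.
- exact: mcI.
- by move=> x _; rewrite mule_ge0 ?lee_fin.
- exact: mcI.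
rewrite !ge0_integralZl ?lee_fin//; [|exact: mI..].
rewrite !integral_indic//= !setIT !lebesgue_measure_itv/=.
transitivity ((psi S)%:E * 1%:E + (psi (- S))%:E * 1%:E)%E.
  by congr (_ * _ + _ * _)%E; rewrite lte_fin ?ltr01 ?ltrN10 -EFinD ?subr0 ?add0r ?opprK.
by rewrite -!EFinM -EFinD !mulr1.
Qed.

Lemma kt_sumE p (x y : R) : x != 0 ->
  expR (- x) * (\sum_(i < p.+1) 'C(p, i)%:R * chi (p + i) x * tau i y) =
  x ^+ p.*2 * kt_sum p x y.
Proof.
move=> x0; rewrite /kt_sum /bessel_sum !mulr_sumr; apply: eq_bigr => i _.
rewrite /kap doubleD exprD -exprM mul2n.
have xp : x ^+ p.*2 != 0 by rewrite expf_neq0.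
have xi : x ^+ i.*2 != 0 by rewrite expf_neq0.
by field; rewrite xp xi.
Qed.

End sphere.

Unset Implicit Arguments.

Theorem theorem1p3 (R : realType) (p n : nat) (Rad : R) (s : n.-tuple R) :
  n = p.*2.+1 -> 0 < Rad -> eucl_norm s < Rad ->
  sphere_int Rad (fun x : n.-tuple R => (expR (- eucl_dist x s))%:E) =
  ((n`!%:R * omega R n) *
   ((-1) ^+ p * expR (- Rad) / (2 ^+ p * p`!%:R) *
    \sum_(i < p.+1) 'C(p, i)%:R * chi (p + i) Rad * tau i (eucl_norm s)))%:E.
Proof.
move=> hn r0 sr; have rn0 : Rad != 0 by rewrite gt_eqF.
have S0 : 0 <= eucl_norm s by exact: sqrtr_ge0.
have md := measurable_dist_exp Rad (eucl_norm s).
rewrite sphere_int_dist.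
have mc : measurable_fun [set: R] (fun=> 1 : R) by exact: measurable_cst.
set L := lebint _.
(* The volume takes the same shape with [psi = 1] and [d = 1], so that both integrals carry the same
   constant. *)
have omegaE : omega R n = fine (lebint (fun x : n.-tuple R =>
    (if (eucl_norm x < 1)%R then
      if sqn x == 0%R then 1 else (fun=> 1) (dotp x s / eucl_norm x)%R
    else 0%R)%:E)).
  congr fine; apply: (congr1 (@lebint R n)); apply/funext => x.
  by case: ifP => //; rewrite if_same.
have -> : (-1) ^+ p * expR (- Rad) / (2 ^+ p * p`!%:R) *
    (\sum_(i < p.+1) 'C(p, i)%:R * chi (p + i) Rad * tau i (eucl_norm s)) =
    (-1) ^+ p / (2 ^+ p * p`!%:R) * (Rad ^+ p.*2 * kt_sum p Rad (eucl_norm s)).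
  rewrite -kt_sumE//; move: (2 ^+ p * _) ((-1) ^+ p) => a b; ring.
(* For [p = 0] the sphere is two points; from dimension 3 on, the slope coordinate is available. *)
rewrite omegaE {omegaE} /L {L}; case: p hn => [|q] hn.
  rewrite double0 in hn; subst n.
  rewrite (lebint1_ball s md (fun _ => expR_ge0 _) (expR_ge0 _)).
  rewrite (lebint1_ball s mc (fun _ => ler01) ler01).
  rewrite kt_sum0 /= !expr0 -!EFinM; congr EFin.
  rewrite /dist_exp.
  have -> : Rad ^+ 2 + eucl_norm s ^+ 2 - 2 * Rad * eucl_norm s =
    (Rad - eucl_norm s) ^+ 2 by ring.
  have -> : Rad ^+ 2 + eucl_norm s ^+ 2 - 2 * Rad * - eucl_norm s =
    (Rad + eucl_norm s) ^+ 2 by ring.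
  rewrite !sqrtr_sqr !gtr0_norm; [|lra|lra].
  rewrite opprB opprD addrC [eucl_norm s - _]addrC !expRD /cosh !factS fact0 muln1.
  by field.
rewrite doubleS in hn; subst n.
(* The dimension is [k.+2] with [k = 2 q + 1]; the same [c] multiplies both sides and cancels. *)
have [c c0 cE] := @lebint_ball_angular R q.*2.+1.
rewrite (cE s _ _ md (fun _ => expR_ge0 _) (expR_ge0 _)).
rewrite (cE s _ _ mc (fun _ => ler01) ler01).
rewrite angular_value ?S0// hyp_integralT -!EFinM /=; congr EFin.
(* With [p = q + 1] and [n! = n (2 p)!], the factorials of [beta] cancel and [4 ^+ p / 2 ^+ p]
   leaves the [2 ^+ p] of [(- 2) ^+ p]. *)
rewrite doubleS exprNn [in RHS]factS natrM /beta doubleS.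
have -> : 4 = 2 * 2 :> R by rewrite -natrM.
rewrite exprMn.
have n0 k : k`!%:R != 0 :> R by rewrite pnatr_eq0 -lt0n fact_gt0.
have t0 : 2 ^+ q.+1 != 0 :> R by rewrite expf_neq0.
move: (n0 q.+1) (n0 q.*2.+2) t0.
move: (2 ^+ q.+1) ((-1) ^+ q.+1) (q.+1)`!%:R (q.*2.+2)`!%:R (Rad ^+ _) (q.*2.+3)%:R.
move: (kt_sum _ _ _) (q`!%:R) => K a A B C D E F A0 D0 E0.
by field; rewrite ?A0 ?D0 ?E0.
Qed.
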